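(* Let $K$ be a field with $\operatorname{char} K \neq 2$, let $a,b,c \in K^\times$, $\varepsilon_1,\varepsilon_2,\varepsilon_3 \in \{1,-1\}$, and let $x_1,x_2,x_3$ be independent indeterminates over $K$. Let $G$ be the group of $K$-automorphisms of $K(x_1,x_2,x_3)$ generated by $$\sigma_1: x_1 \mapsto \varepsilon_1 x_1,\ x_2 \mapsto \varepsilon_2 x_2,\ x_3 \mapsto \frac{c}{x_3},\qquad \sigma_2: x_1 \mapsto \frac{a}{x_1},\ x_2 \mapsto \frac{b}{x_2},\ x_3 \mapsto \varepsilon_3 x_3.$$ If $\varepsilon_1=\varepsilon_2=1$ or $\varepsilon_3=1$, then $K(x_1,x_2,x_3)^G$ is rational over $K$. If $\varepsilon_1=\varepsilon_2=\varepsilon_3=-1$, then $K(x_1,x_2,x_3)^G$ is rational over $K$ if and only if $K(x_1,x_2,x_3)^{\langle \sigma_{a,b,c}\rangle}$ is rational over $K$, where $\sigma_{a,b,c}$ is the $K$-automorphism $x_1 \mapsto -x_1$, $x_2 \mapsto \frac{a}{x_2}$, $x_3 \mapsto \frac{-bx_1^2+c}{x_3}$.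
   Context: Rational over $K$ means purely transcendental over $K$. For a group $H$ of automorphisms of a field $F$, $F^H$ is the fixed subfield. *)

(* Defs.v *)
From HB Require Import structures.
From mathcomp Require Import all_boot all_order all_algebra.
From mathcomp Require Export fraction generic_quotient.
From mathcomp.multinomials Require Export mpoly.

Set Implicit Arguments.
Unset Strict Implicit.
Unset Printing Implicit Defensive.

Import GRing.Theory.
Local Open Scope ring_scope.

Section PurelyTranscendental.
Variables (K L : fieldType) (j : {rmorphism K -> L}).

(* K(B), the smallest subfield of L containing K (embedded by j) and B; the last
   constructor is harmless at 0 since 0^-1 = 0. *)
Inductive adjoin (B : L -> Prop) : L -> Prop :=
  | adjoin_base k : adjoin B (j k)
  | adjoin_mem x of B x : adjoin B x
  | adjoin_add x y of adjoin B x & adjoin B y : adjoin B (x + y)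
  | adjoin_opp x of adjoin B x : adjoin B (- x)
  | adjoin_mul x y of adjoin B x & adjoin B y : adjoin B (x * y)
  | adjoin_inv x of adjoin B x : adjoin B x^-1.

Definition alg_independent (B : L -> Prop) : Prop :=
  forall (n : nat) (t : 'I_n -> L), injective t -> (forall i, B (t i)) ->
  forall p : {mpoly K[n]}, mmap j t p = 0 -> p = 0.

(* E is meant to be (the underlying set of) an intermediate field of L / K. *)
Definition purely_transcendental (E : L -> Prop) : Prop :=
  exists B : L -> Prop,
    alg_independent B /\ (forall x, E x <-> adjoin B x).

Definition Kautomorphism (s : {rmorphism L -> L}) : Prop :=
  bijective s /\ (forall k, s (j k) = j k).

End PurelyTranscendental.

Section FixedField.
Variable L : fieldType.

(* Automorphisms are represented by their underlying functions. *)
Inductive generated_group (S : (L -> L) -> Prop) : (L -> L) -> Prop :=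
  | gen_id : generated_group S id
  | gen_mem s of S s : generated_group S s
  | gen_comp s t of generated_group S s & generated_group S t :
      generated_group S (s \o t)
  | gen_inv s t of generated_group S s & cancel s t & cancel t s :
      generated_group S t.

Definition fixed_field (H : (L -> L) -> Prop) (x : L) : Prop :=
  forall s, H s -> s x = x.

End FixedField.

Section RationalFunctions.
Variables (K : fieldType) (n : nat).

Definition ratfun : fieldType := {fraction {mpoly K[n]}}.

Definition ratC : {rmorphism K -> ratfun} :=
  (@FracField.tofrac {mpoly K[n]} \o @mpolyC n K)%FUN.

Definition ratX (i : 'I_n) : ratfun := FracField.tofrac 'X_i.

End RationalFunctions.

Definition x1 (K : fieldType) : ratfun K 3 := ratX K (@Ordinal 3 0 isT).
Definition x2 (K : fieldType) : ratfun K 3 := ratX K (@Ordinal 3 1 isT).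
Definition x3 (K : fieldType) : ratfun K 3 := ratX K (@Ordinal 3 2 isT).
Arguments x1 {K}.
Arguments x2 {K}.
Arguments x3 {K}.

Notation "c %:K" := (ratC _ 3 c) (at level 2, format "c %:K") : ring_scope.

Section ClearDenominators.
Variables (K F : fieldType) (n : nat).
Variables (iota phi : {rmorphism {mpoly K[n]} -> F}).
Hypothesis phiC : forall k, phi k%:MP = iota k%:MP.

Let P (q : {mpoly K[n]}) := exists N p : {mpoly K[n]},
  [/\ phi N != 0, iota p = iota N * phi q & phi p = phi N * iota q].

Hypothesis PX : forall i, P 'X_i.

Lemma clear_denominators (q : {mpoly K[n]}) : P q.
Proof.
have PC k : P k%:MP.
  by exists 1, k%:MP; rewrite !rmorph1 !mul1r oner_neq0 phiC.
have PM q1 q2 : P q1 -> P q2 -> P (q1 * q2).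
  move=> [N1 [p1 [n1 e1 f1]]] [N2 [p2 [n2 e2 f2]]].
  exists (N1 * N2), (p1 * p2); rewrite !rmorphM /= mulf_neq0 // e1 e2 f1 f2.
  by rewrite mulrACA [phi N1 * _ * _]mulrACA.
have PD q1 q2 : P q1 -> P q2 -> P (q1 + q2).
  move=> [N1 [p1 [n1 e1 f1]]] [N2 [p2 [n2 e2 f2]]].
  exists (N1 * N2), (p1 * N2 + p2 * N1).
  rewrite !(rmorphM, rmorphD) /= e1 e2 f1 f2 mulf_neq0 //.
  by split=> //; rewrite mulrDr; congr (_ + _); rewrite mulrAC // [X in X * _]mulrC.
elim/mpolyind: q => [|k m p _ _ IH]; first by have := PC 0; rewrite mpolyC0.
apply: (PD _ _ _ IH); rewrite -mul_mpolyC; apply: (PM _ _ (PC k)); rewrite mpolyXE_id.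
have Pone : P 1 by have := PC 1; rewrite mpolyC1.
apply: (big_ind P Pone PM) => i _; elim: (m i) => [|d IHd]; first by rewrite expr0.
rewrite exprS; exact: (PM _ _ (PX i) IHd).
Qed.

Lemma clear_denominators_neq0 (q : {mpoly K[n]}) :
  injective iota -> q != 0 -> phi q != 0.
Proof.
move=> iota_inj; apply: contra_neq => q0.
have [N [p [n0 e f]]] := clear_denominators q.
have p0 : p = 0 by apply: iota_inj; rewrite e q0 mulr0 rmorph0.
move/eqP: f; rewrite p0 rmorph0 eq_sym mulf_eq0 (negPf n0) /= => /eqP q0'.
by apply: iota_inj; rewrite q0' rmorph0.
Qed.

End ClearDenominators.

Section FractionExtension.
Variables (R : idomainType) (F L : fieldType).
Variables (iota : {rmorphism R -> F}) (phi : {rmorphism R -> L}).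
Hypothesis iota_neq0 : forall q, q != 0 -> iota q != 0.
Hypothesis phi_neq0 : forall q, q != 0 -> phi q != 0.
Hypothesis iota_frac :
  forall f, exists pq : R * R, (pq.2 != 0) && (f == iota pq.1 / iota pq.2).

Let ext f := phi (xchoose (iota_frac f)).1 / phi (xchoose (iota_frac f)).2.

Let extE p q : q != 0 -> ext (iota p / iota q) = phi p / phi q.
Proof.
move=> q0; rewrite /ext; case: xchoose (xchooseP (iota_frac (iota p / iota q))).
move=> p' q' /= /andP[q0' /eqP/eqP]; rewrite eqr_div ?iota_neq0 // -!rmorphM.
rewrite -subr_eq0 -rmorphB => /eqP e; apply/eqP.
rewrite eqr_div ?phi_neq0 // -!rmorphM -subr_eq0 -rmorphB.
have /eqP : p * q' - p' * q = 0.
  by apply/eqP; apply: contraT => /iota_neq0; rewrite e eqxx.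
by rewrite subr_eq0 => /eqP ->; rewrite subrr rmorph0.
Qed.

Lemma fraction_extension :
  exists s : {rmorphism F -> L}, forall p, s (iota p) = phi p.
Proof.
have dec f : exists p q, q != 0 /\ f = iota p / iota q.
  by have [[p q] /= /andP[q0 /eqP ->]] := iota_frac f; exists p, q.
have ext_iota p : ext (iota p) = phi p.
  by have := @extE p 1 (oner_neq0 _); rewrite !rmorph1 !divr1.
have extB : zmod_morphism ext.
  move=> f g; have [p [q [q0 ->]]] := dec f; have [p' [q' [q0' ->]]] := dec g.
  rewrite -mulNr -rmorphN addf_div ?iota_neq0 // -!rmorphM -rmorphD.
  rewrite !extE ?mulf_neq0 // rmorphD !rmorphM rmorphN /=.
  by rewrite -addf_div ?phi_neq0 // mulNr.
have extM : monoid_morphism ext.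
  split=> [|f g]; first by rewrite -(rmorph1 iota) ext_iota rmorph1.
  have [p [q [q0 ->]]] := dec f; have [p' [q' [q0' ->]]] := dec g.
  by rewrite mulf_div -!rmorphM !extE ?mulf_neq0 // !rmorphM mulf_div.
pose A := GRing.isZmodMorphism.Build _ _ ext extB.
pose M := GRing.isMonoidMorphism.Build _ _ ext extM.
pose s : {rmorphism F -> L} := HB.pack ext A M.
by exists s.
Qed.

End FractionExtension.

Lemma ratfun_frac (K : fieldType) (n : nat) (f : ratfun K n) :
  exists pq : {mpoly K[n]} * {mpoly K[n]}, (pq.2 != 0) &&
   (f == FracField.tofrac pq.1 / FracField.tofrac pq.2 :> ratfun K n).
Proof.
exists (\n_(repr f), \d_(repr f)); rewrite denom_ratioP /=; apply/eqP.
have d0 : FracField.tofrac (\d_(repr f)) != 0 :> ratfun K n.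
  by rewrite tofrac_eq0 denom_ratioP.
apply: (canRL (mulfK d0)).
rewrite -{1}[f]reprK /FracField.tofrac; unlock.
rewrite -[LHS]FracField.pi_mul.
apply/eqP; rewrite piE FracField.equivfE.
by rewrite !numden_Ratio ?oner_neq0 ?mulr1 ?denom_ratioP // mulrC.
Qed.

Lemma involution_extension (K F : fieldType) (n : nat)
    (iota phi : {rmorphism {mpoly K[n]} -> F}) :
    (forall q, q != 0 -> iota q != 0) ->
    (forall f, exists pq, (pq.2 != 0) && (f == iota pq.1 / iota pq.2)) ->
    (forall k, phi k%:MP = iota k%:MP) ->
    (forall i, exists N p : {mpoly K[n]},
      [/\ phi N != 0, iota p = iota N * phi 'X_i & phi p = phi N * iota 'X_i]) ->
  exists s : {rmorphism F -> F}, bijective s /\ (forall p, s (iota p) = phi p).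
Proof.
move=> iota0 iota_frac phiC phiX.
have iota_inj : injective iota.
  move=> p q /eqP; rewrite -subr_eq0 -rmorphB => e; apply/eqP.
  by rewrite -subr_eq0; apply: contraT => /iota0; rewrite e.
have cd := clear_denominators phiC phiX.
have phi0 q := clear_denominators_neq0 phiC phiX (q := q) iota_inj.
have [s sE] := fraction_extension iota0 phi0 iota_frac.
exists s; split=> //.
have ssE q : s (s (iota q)) = iota q.
  have [N [p [N0 e f]]] := cd q; apply: (mulfI N0).
  by rewrite -f -(sE p) e rmorphM !sE.
have sK : cancel s s.
  move=> f; have [[p q] /= /andP[q0 /eqP ->]] := iota_frac f.
  by rewrite !fmorph_div !ssE.
by exists s.
Qed.

Lemma Kautomorphism_exists (K : fieldType) (n : nat) (v : 'I_n -> ratfun K n) :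
    let phi := mmap (ratC K n) v in
    (forall i, exists N p : {mpoly K[n]},
      [/\ phi N != 0, FracField.tofrac p = FracField.tofrac N * v i
        & phi p = phi N * ratX K i]) ->
  exists s : {rmorphism ratfun K n -> ratfun K n},
    Kautomorphism (ratC K n) s /\ (forall i, s (ratX K i) = v i).
Proof.
move=> phi vE.
pose iota : {rmorphism {mpoly K[n]} -> ratfun K n} := @FracField.tofrac {mpoly K[n]}.
pose f : {rmorphism {mpoly K[n]} -> ratfun K n} := phi.
have fX i : f 'X_i = v i by rewrite /f /= /phi mmapX mmap1U.
have fC k : f k%:MP = iota k%:MP by rewrite /f /= /phi mmapC.
have i0 q : q != 0 -> iota q != 0 by rewrite /iota /= tofrac_eq0.
have fE i : exists N p : {mpoly K[n]},
    [/\ f N != 0, iota p = iota N * f 'X_i & f p = f N * iota 'X_i].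
  by have [N [p [? ? ?]]] := vE i; exists N, p; rewrite fX.
have [s [sb sE]] := involution_extension i0 (@ratfun_frac K n) fC fE.
by exists s; split=> [|i]; [split=> // k; rewrite [LHS]sE fC | rewrite [LHS]sE fX].
Qed.

Lemma ratX_neq0 (K : fieldType) (n : nat) (i : 'I_n) : ratX K i != 0.
Proof.
rewrite tofrac_eq0; apply/eqP => /(congr1 (mcoeff U_(i)%MM)).
by rewrite mcoeffX eqxx mcoeff0; apply/eqP; exact: oner_neq0.
Qed.

Lemma div_cond (F : fieldType) (g x : F) : g != 0 -> x != 0 ->
  [/\ g / x != 0, g = x * (g / x) & g = g / x * x].
Proof.
move=> g0 x0; rewrite mulf_neq0 ?invr_eq0 // divfK //.
by rewrite mulrCA divff ?mulr1.
Qed.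

Section Substitution.
Variables (K : fieldType) (n : nat) (v : 'I_n -> ratfun K n).
Let phi := mmap (ratC K n) v.

Lemma scale_cond (e : K) i : e * e = 1 -> v i = ratC K n e * ratX K i ->
  exists N p : {mpoly K[n]},
    [/\ phi N != 0, FracField.tofrac p = FracField.tofrac N * v i
      & phi p = phi N * ratX K i].
Proof.
move=> ee vi; exists 1, (e%:MP * 'X_i).
rewrite /phi (rmorphM (mmap _ _)) rmorph1 rmorph1 /= !mul1r mmapC mmapX mmap1U.
rewrite oner_neq0 vi; split=> //; first by rewrite rmorphM.
have eeC : ratC K n e * ratC K n e = 1 by rewrite -rmorphM ee rmorph1.
by rewrite mulrA eeC mul1r.
Qed.

Lemma inverse_cond (g : {mpoly K[n]}) i : g != 0 -> phi g = FracField.tofrac g ->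
  v i = FracField.tofrac g / ratX K i ->
  exists N p : {mpoly K[n]},
    [/\ phi N != 0, FracField.tofrac p = FracField.tofrac N * v i
      & phi p = phi N * ratX K i].
Proof.
move=> g0 pg vi; have x0 := ratX_neq0 K i; exists 'X_i, g.
have -> : phi 'X_i = v i by rewrite /phi mmapX mmap1U.
have G0 : FracField.tofrac g != 0 :> ratfun K n by rewrite tofrac_eq0.
by rewrite pg vi; apply: (@div_cond (ratfun K n)).
Qed.

End Substitution.

Definition triple (T : Type) (u1 u2 u3 : T) (i : 'I_3) : T :=
  nth u1 [:: u1; u2; u3] i.

Lemma sign_sqr (K : fieldType) (e : K) : e = 1 \/ e = -1 -> e * e = 1.
Proof. by case=> ->; rewrite ?mulrNN mulr1. Qed.

Lemma ratfunC_cond (K : fieldType) n (v : 'I_n -> ratfun K n) (k : K) :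
  mmap (ratC K n) v k%:MP = FracField.tofrac k%:MP.
Proof. by rewrite mmapC. Qed.

Lemma mpolyC_neq0 (K : fieldType) n (k : K) : k != 0 -> k%:MP != 0 :> {mpoly K[n]}.
Proof. by rewrite mpolyC_eq0. Qed.

(* The three substitutions of interest do define K-automorphisms. *)
Lemma sigma1_exists (K : fieldType) (c e1 e2 : K) :
    c != 0 -> e1 = 1 \/ e1 = -1 -> e2 = 1 \/ e2 = -1 ->
  exists s : {rmorphism ratfun K 3 -> ratfun K 3},
    Kautomorphism (ratC K 3) s /\
    [/\ s x1 = e1%:K * x1, s x2 = e2%:K * x2 & s x3 = c%:K / x3].
Proof.
move=> c0 h1 h2.
have [|s [sa sX]] := @Kautomorphism_exists K 3
    (triple (e1%:K * x1) (e2%:K * x2) (c%:K / x3)); last first.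
  by exists s; split=> //; split; rewrite [LHS]sX.
case=> [[|[|[|//]]] hi].
- by apply: (scale_cond (sign_sqr h1)); rewrite /triple /= (bool_irrelevance hi isT).
- by apply: (scale_cond (sign_sqr h2)); rewrite /triple /= (bool_irrelevance hi isT).
apply: (inverse_cond (mpolyC_neq0 3 c0) (ratfunC_cond _ _)).
by rewrite /triple /= (bool_irrelevance hi isT).
Qed.

Lemma sigma2_exists (K : fieldType) (a b e3 : K) :
    a != 0 -> b != 0 -> e3 = 1 \/ e3 = -1 ->
  exists s : {rmorphism ratfun K 3 -> ratfun K 3},
    Kautomorphism (ratC K 3) s /\
    [/\ s x1 = a%:K / x1, s x2 = b%:K / x2 & s x3 = e3%:K * x3].
Proof.
move=> a0 b0 h3.
have [|s [sa sX]] := @Kautomorphism_exists K 3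
    (triple (a%:K / x1) (b%:K / x2) (e3%:K * x3)); last first.
  by exists s; split=> //; split; rewrite [LHS]sX.
case=> [[|[|[|//]]] hi].
- apply: (inverse_cond (mpolyC_neq0 3 a0) (ratfunC_cond _ _)).
  by rewrite /triple /= (bool_irrelevance hi isT).
- apply: (inverse_cond (mpolyC_neq0 3 b0) (ratfunC_cond _ _)).
  by rewrite /triple /= (bool_irrelevance hi isT).
by apply: (scale_cond (sign_sqr h3)); rewrite /triple /= (bool_irrelevance hi isT).
Qed.

Lemma sigma_abc_exists (K : fieldType) (a b c : K) : a != 0 -> c != 0 ->
  exists s : {rmorphism ratfun K 3 -> ratfun K 3},
    Kautomorphism (ratC K 3) s /\
    [/\ s x1 = - x1, s x2 = a%:K / x2
      & s x3 = (- b%:K * x1 ^+ 2 + c%:K) / x3].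
Proof.
move=> a0 c0; pose X1 : {mpoly K[3]} := 'X_(@Ordinal 3 0 isT).
pose g : {mpoly K[3]} := (- b)%:MP * X1 ^+ 2 + c%:MP.
have gE : FracField.tofrac g = - b%:K * x1 ^+ 2 + c%:K :> ratfun K 3.
  by rewrite /g rmorphD rmorphM rmorphXn mpolyCN rmorphN.
have g0 : g != 0.
  apply/eqP => /(congr1 (mcoeff 0%MM)) /eqP.
  rewrite /g mcoeffD mcoeffCM mcoeffC eqxx mulr1 mcoeff0 /X1 mpolyXn mcoeffX.
  case: (_ =P 0%MM) => [/(congr1 (fun m : 'X_{1..3} => m (@Ordinal 3 0 isT)))|_].
    by rewrite mulmnE mnm1E mnm0E eqxx.
  by rewrite mulr0 add0r (negPf c0).
have [|s [sa sX]] := @Kautomorphism_exists K 3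
    (triple (- x1) (a%:K / x2) (FracField.tofrac g / x3)); last first.
  by exists s; split=> //; rewrite -gE; split; rewrite [LHS]sX.
case=> [[|[|[|//]]] hi].
- apply: (@scale_cond _ _ _ (-1)); first by rewrite mulrNN mulr1.
  by rewrite (rmorphN1 (ratC K 3)) (@mulN1r (ratfun K 3)) (bool_irrelevance hi isT).
- apply: (inverse_cond (mpolyC_neq0 3 a0) (ratfunC_cond _ _)).
  by rewrite /triple /= (bool_irrelevance hi isT).
apply: (inverse_cond g0); last by rewrite /triple /= (bool_irrelevance hi isT).
have phi_g v : mmap (ratC K 3) v g = (- b)%:K * v (@Ordinal 3 0 isT) ^+ 2 + c%:K.
  rewrite /g (rmorphD (mmap _ _)) (rmorphM (mmap _ _)) (rmorphXn (mmap _ _)) /=.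
  by rewrite !mmapC mmapX mmap1U.
by rewrite gE phi_g (rmorphN (ratC K 3)) (@sqrrN (ratfun K 3)).
Qed.

(* Main.v *)
Require Import Defs.
From HB Require Import structures.
From mathcomp Require Import all_boot all_order all_algebra.
From mathcomp Require Import fraction ring zify.
From mathcomp.multinomials Require Import mpoly.

Set Implicit Arguments.
Unset Strict Implicit.
Unset Printing Implicit Defensive.

Import GRing.Theory.
Local Open Scope ring_scope.

(** Write P_i = x_i + a_i/x_i and M_i = x_i - a_i/x_i with (a_1, a_2, a_3) = (a, b, c).
    The fixed field of (x1, x2) -> (a/x1, b/x2) is generated by u = M_1/M_12 and
    v = M_2/M_12, where M_12 = x1 x2 - ab/(x1 x2).  In the first two cases explicit
    generators follow: u, v and P_3, where a sign is absorbed by a factor M_3 or M_1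
    that the other involution negates.

    When all signs are -1, both fixed fields turn out to be K(p, w, r)(q) with
    p, w, r independent and q^2 (r^2 - c) = (p^2 - a)(w^2 - b), hence they are
    isomorphic over K.  For sigma_{a,b,c} these are the coordinates of x2 = p + q x1
    and x3 = r + w x1 over the fixed field.  For G one takes p = M_3 P_1/(2 P_3),
    w = M_3 P_2/(2 P_3) and q = (M_1 P_2 - P_1 M_2)/(2 P_3).

    Fixed fields are computed through towers of quadratic extensions in which an
    involution negates the square root; algebraic independence is read off from
    leading monomials. *)

(** * Adjunction and fixed fields *)

Definition range (T : Type) (n : nat) (t : 'I_n -> T) (x : T) : Prop :=
  exists i, x = t i.

Lemma rmorph_mmap (n : nat) (R S T : nzRingType) (phi : {rmorphism S -> T})
    (f : R -> S) (h : 'I_n -> S) (p : {mpoly R[n]}) :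
  phi (mmap f h p) = mmap (phi \o f) (phi \o h) p.
Proof.
rewrite /mmap rmorph_sum; apply: eq_bigr => m _.
rewrite rmorphM rmorph_prod; congr (_ * _).
by apply: eq_bigr => i _; rewrite rmorphXn.
Qed.

Lemma eq_mmap (n : nat) (R S : nzRingType) (f g : R -> S) (h k : 'I_n -> S)
    (p : {mpoly R[n]}) :
  f =1 g -> h =1 k -> mmap f h p = mmap g k p.
Proof. by move=> fg hk; apply: eq_bigr => m _; rewrite fg (mmap1_eq m hk). Qed.

Lemma mmap_id (n : nat) (R : nzRingType) (p : {mpoly R[n]}) :
  mmap (@mpolyC n R) (fun i => 'X_i) p = p.
Proof.
rewrite [RHS]mpolyE; apply: eq_bigr => m _.
by rewrite mul_mpolyC mpolyXE_id.
Qed.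

Section Adjoin.
Variables (K L : fieldType) (j : {rmorphism K -> L}).

Lemma adjoin_nat (B : L -> Prop) (n : nat) : adjoin j B n%:R.
Proof. by rewrite -(rmorph_nat j); apply: adjoin_base. Qed.

Lemma adjoin_sub (B C : L -> Prop) (x : L) :
  (forall y, B y -> adjoin j C y) -> adjoin j B x -> adjoin j C x.
Proof.
move=> BC; elim=> [k|y /BC //|y z _ ? _ ?|y _ ?|y z _ ? _ ?|y _ ?].
- exact: adjoin_base.
- exact: adjoin_add.
- exact: adjoin_opp.
- exact: adjoin_mul.
- exact: adjoin_inv.
Qed.

Lemma adjoin_exp (B : L -> Prop) (x : L) (n : nat) :
  adjoin j B x -> adjoin j B (x ^+ n).
Proof.
move=> Bx; elim: n => [|n IHn]; first exact: (adjoin_nat B 1).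
by rewrite exprS; apply: adjoin_mul.
Qed.

Lemma adjoin_mmap (B : L -> Prop) (n : nat) (t : 'I_n -> L) (p : {mpoly K[n]}) :
  (forall i, adjoin j B (t i)) -> adjoin j B (mmap j t p).
Proof.
move=> Bt; rewrite /mmap; apply: big_ind => [||m _].
- exact: (adjoin_nat B 0).
- exact: adjoin_add.
apply: adjoin_mul; first exact: adjoin_base.
apply: big_ind => [||i _]; first exact: (adjoin_nat B 1).
- exact: adjoin_mul.
- exact: adjoin_exp.
Qed.

Lemma adjoin_fixed (B : L -> Prop) (s : {rmorphism L -> L}) (x : L) :
    (forall k, s (j k) = j k) -> (forall y, B y -> s y = y) ->
  adjoin j B x -> s x = x.
Proof.
move=> sj sB; elim=> [k|y /sB //|y z _ Ey _ Ez|y _ Ey|y z _ Ey _ Ez|y _ Ey] //.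
- by rewrite rmorphD Ey Ez.
- by rewrite rmorphN Ey.
- by rewrite rmorphM Ey Ez.
- by rewrite fmorphV Ey.
Qed.

Lemma adjoin_sqrt (B : L -> Prop) (z x : L) :
    adjoin j B (z ^+ 2) -> adjoin j (fun y => B y \/ y = z) x ->
  exists e0 e1, [/\ adjoin j B e0, adjoin j B e1 & x = e0 + e1 * z].
Proof.
move=> Bz2.
have B0 := adjoin_nat B 0; have B1 := adjoin_nat B 1.
have in_base y : adjoin j B y ->
    exists e0 e1, [/\ adjoin j B e0, adjoin j B e1 & y = e0 + e1 * z].
  by exists y, 0; rewrite mul0r addr0.
elim=> [k|y [By| ->]|y1 y2 _ [e0 [e1 [? ? ->]]] _ [f0 [f1 [? ? ->]]]|
        y _ [e0 [e1 [? ? ->]]]|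
        y1 y2 _ [e0 [e1 [? ? ->]]] _ [f0 [f1 [? ? ->]]]|
        y _ [e0 [e1 [Be0 Be1 ->]]]].
- by apply: in_base; apply: adjoin_base.
- by apply: in_base; apply: adjoin_mem.
- by exists 0, 1; rewrite mul1r add0r.
- exists (e0 + f0), (e1 + f1); split; try exact: adjoin_add.
  by rewrite mulrDl addrACA.
- exists (- e0), (- e1); split; try exact: adjoin_opp.
  by rewrite opprD mulNr.
- exists (e0 * f0 + e1 * f1 * z ^+ 2), (e0 * f1 + e1 * f0); split; last by ring.
    by apply: adjoin_add; apply: adjoin_mul => //; apply: adjoin_mul.
  by apply: adjoin_add; apply: adjoin_mul.
have [->|nz] := eqVneq (e0 + e1 * z) 0; first by apply: in_base; rewrite invr0.
have [e0E|nz'] := eqVneq (e0 - e1 * z) 0.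
  apply/in_base/adjoin_inv.
  have -> : e0 + e1 * z = 2%:R * e0 by rewrite -[e1 * z](subrK e0) -opprB e0E; ring.
  by apply: adjoin_mul => //; apply: adjoin_nat.
pose d := e0 ^+ 2 - e1 ^+ 2 * z ^+ 2.
have dE : d = (e0 + e1 * z) * (e0 - e1 * z) by rewrite /d; ring.
have Bd : adjoin j B d^-1.
  apply/adjoin_inv/adjoin_add; first exact: adjoin_exp.
  by apply/adjoin_opp/adjoin_mul => //; apply: adjoin_exp.
exists (e0 / d), (- e1 / d); split; try apply: adjoin_mul => //.
  exact: adjoin_opp.
by rewrite dE; field; rewrite nz nz'.
Qed.

Lemma fixed_adjoin_sqrt (B : L -> Prop) (s : {rmorphism L -> L}) (z x : L) :
    2%:R != 0 :> L -> adjoin j B (z ^+ 2) -> (forall k, s (j k) = j k) ->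
    (forall y, B y -> s y = y) -> s z = - z ->
  adjoin j (fun y => B y \/ y = z) x -> s x = x -> adjoin j B x.
Proof.
move=> two0 Bz sj sB sz /(adjoin_sqrt Bz)[e0 [e1 [B0 B1 ->]]].
rewrite rmorphD rmorphM /= sz !(adjoin_fixed sj sB) // => /addrI e1z.
have /eqP : 2%:R * (e1 * z) = 0 by rewrite mulr_natl mulr2n -{1}e1z mulrN addNr.
by rewrite mulf_eq0 (negPf two0) /= => /eqP ->; rewrite addr0.
Qed.

Lemma purely_transcendental_range (n : nat) (t : 'I_n -> L) (E : L -> Prop) :
    (forall p : {mpoly K[n]}, mmap j t p = 0 -> p = 0) ->
    (forall x, E x <-> adjoin j (range t) x) ->
  purely_transcendental j E.
Proof.
move=> t_ind EE; exists (range t); split=> // m u u_inj u_t p pu0.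
have [h hE] : exists h : {ffun 'I_m -> 'I_n}, forall i, u i = t (h i).
  have [h hE] := fin_all_exists u_t.
  by exists (finfun h) => i; rewrite ffunE.
have h_inj : injective h by move=> i i' hi; apply: u_inj; rewrite !hE hi.
pose f := mmap (@mpolyC n K) (fun i => 'X_(h i)) : {mpoly K[m]} -> {mpoly K[n]}.
pose g := mmap (@mpolyC m K)
  (fun i => if [pick i' | h i' == i] is Some i' then 'X_i' else 0).
have f0 : f p = 0.
  apply: t_ind; rewrite -[RHS]pu0 /f (rmorph_mmap (mmap j t)); apply: eq_mmap => [k|i] /=.
    by rewrite mmapC.
  by rewrite mmapX mmap1U hE.
suff gfE : g (f p) = p by rewrite -gfE f0 /g raddf0.
rewrite /g /f (rmorph_mmap (mmap _ _)) -[RHS]mmap_id.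
apply: eq_mmap => [k|i] /=; first by rewrite mmapC.
rewrite mmapX mmap1U; case: pickP => [i' /eqP/h_inj -> //|].
by move/(_ i); rewrite eqxx.
Qed.

Lemma purely_transcendental_ext (E E' : L -> Prop) :
  (forall x, E x <-> E' x) -> purely_transcendental j E -> purely_transcendental j E'.
Proof.
by move=> EE' [B [B_ind BE]]; exists B; split=> // x; rewrite -EE'.
Qed.

End Adjoin.

Lemma fixed_field_gen1 (L : fieldType) (s : L -> L) (x : L) :
  fixed_field (generated_group (fun t => t = s)) x <-> s x = x.
Proof.
split=> [fx|sx t]; first by apply: fx; apply: gen_mem.
elim=> [//|_ -> //|u v _ ux _ vx|u v _ ux uK _] /=; first by rewrite vx ux.
by rewrite -{1}ux uK.
Qed.

Lemma fixed_field_gen2 (L : fieldType) (s1 s2 : L -> L) (x : L) :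
  fixed_field (generated_group (fun t => t = s1 \/ t = s2)) x <->
  s1 x = x /\ s2 x = x.
Proof.
split=> [fx|[s1x s2x] t].
  by split; apply: fx; apply: gen_mem; [left | right].
elim=> [//|_ [] -> //|u v _ ux _ vx|u v _ ux uK _] /=; first by rewrite vx ux.
by rewrite -{1}ux uK.
Qed.

(** * Independence by leading monomials *)

Lemma seq_argmax (T : eqType) (d : Order.disp_t) (O : orderType d) (f : T -> O)
    (r : seq T) :
  r != [::] -> exists2 x, x \in r & forall y, y \in r -> (f y <= f x)%O.
Proof.
elim: r => [//|x [|x' r] IHr] _.
  by exists x => [|y]; rewrite !inE // => /eqP ->.
have [//|z zr zmax] := IHr.
have [fxz|/Order.POrderTheory.ltW fzx] := Order.TotalTheory.leP (f x) (f z).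
  exists z => [|y]; first by rewrite inE zr orbT.
  by rewrite inE => /predU1P[->//|]; apply: zmax.
exists x => [|y]; first by rewrite inE eqxx.
rewrite inE => /predU1P[->//|/zmax yz].
exact: Order.POrderTheory.le_trans yz fzx.
Qed.

Section LeadingMonomials.
Variables (K : fieldType) (n : nat).

Lemma sum_distinct_mlead_neq0 (T : eqType) (r : seq T) (F : T -> {mpoly K[n]}) :
    r != [::] -> uniq r -> (forall x, x \in r -> F x != 0) ->
    {in r &, injective (fun x => mlead (F x))} ->
  \sum_(x <- r) F x != 0.
Proof.
move=> r0 r_uniq F0 F_inj.
have [x xr xmax] := seq_argmax (fun x => mlead (F x)) r0.
apply/eqP => /(congr1 (mcoeff (mlead (F x)))); rewrite mcoeff0 raddf_sum /=.
rewrite (bigD1_seq x) //= big_seq_cond big1 => [|y /andP[yr yx]].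
  by rewrite addr0 => /eqP; rewrite mleadc_eq0 (negPf (F0 x xr)).
apply: mcoeff_gt_mlead; rewrite Order.POrderTheory.lt_neqAle xmax // andbT.
by apply: contra yx => /eqP /F_inj ->.
Qed.

Lemma mlead_independent (u v : 'I_n -> {mpoly K[n]}) :
    (forall i, u i != 0) -> (forall i, v i != 0) ->
    (forall m m' : 'X_{1..n},
      (\big[mnm_add/0]_i (mlead (u i) *+ m i + mlead (v i) *+ m' i) =
       \big[mnm_add/0]_i (mlead (u i) *+ m' i + mlead (v i) *+ m i))%MM -> m = m') ->
  forall p : {mpoly K[n]},
  mmap (ratC K n) (fun i => FracField.tofrac (u i) / FracField.tofrac (v i)) p = 0 ->
  p = 0.
Proof.
move=> u0 v0 uv_ind p p0; apply/eqP; apply: contraTT isT => pn0.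
pose N := msize p.
pose F (m : 'X_{1..n}) := p@_m *: \prod_i (u i ^+ m i * v i ^+ (N - m i)).
have ltN m i : m \in msupp p -> (m i <= N)%N.
  move=> /msize_mdeg_lt/ltnW; apply: leq_trans.
  by rewrite mdegE (bigD1 i) //= leq_addr.
have prod0 m : \prod_i (u i ^+ m i * v i ^+ (N - m i)) != 0.
  by apply/prodf_neq0 => i _; rewrite mulf_neq0 ?expf_neq0.
have leadF m : m \in msupp p ->
    mlead (F m) = (\big[mnm_add/0]_i (mlead (u i) *+ m i + mlead (v i) *+ (N - m i)))%MM.
  move=> mp; rewrite mleadZ -?mcoeff_msupp // mlead_prod => [|i _ _].
    by apply: eq_bigr => i _; rewrite mleadM ?expf_neq0 // !mleadX.
  by rewrite mulf_neq0 ?expf_neq0.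
suff : \sum_(m <- msupp p) F m != 0.
  suff -> : \sum_(m <- msupp p) F m = 0 by rewrite eqxx.
  apply/eqP; rewrite -(tofrac_eq0 (\sum_(m <- _) _)); apply/eqP.
  transitivity (\prod_i FracField.tofrac (v i) ^+ N *
      mmap (ratC K n) (fun i => FracField.tofrac (u i) / FracField.tofrac (v i)) p).
    rewrite [LHS]rmorph_sum /mmap mulr_sumr /=.
    apply: eq_big_seq => m mp; rewrite /F -mul_mpolyC rmorphM /= mulrCA.
    congr (_ * _); rewrite rmorph_prod /mmap1 -big_split /=.
    apply: eq_bigr => i _; rewrite rmorphM !rmorphXn /= expr_div_n.
    rewrite -[in RHS](subnK (ltN m i mp)) exprD; set w := FracField.tofrac (v i) ^+ m i.
    have w0 : w != 0 by rewrite expf_neq0 // tofrac_eq0.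
    by rewrite -mulrA [w * _]mulrC divfK // mulrC.
  by rewrite p0 mulr0.
apply: sum_distinct_mlead_neq0 => //.
- by rewrite msupp_eq0.
- by move=> m mp; rewrite scaler_eq0 negb_or prod0 -mcoeff_msupp mp.
move=> m m' mp mp' /=; rewrite !leadF // => lead_eq; apply: uv_ind.
apply/mnmP => k; move/mnmP/(_ k): lead_eq.
have sumE (f : 'I_n -> 'X_{1..n}) :
    (\big[mnm_add/0]_i f i)%MM k = (\sum_i f i k)%N.
  exact: (big_morph (fun m : 'X_{1..n} => m k) (fun m1 m2 => mnmDE k m1 m2) (mnm0E k)).
rewrite !sumE => lead_eq.
have shift (m1 m2 : 'X_{1..n}) : m1 \in msupp p ->
    (\sum_i (mlead (u i) *+ m1 i + mlead (v i) *+ m2 i)%MM k + \sum_i mlead (v i) k * N =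
     \sum_i (mlead (u i) *+ m1 i + mlead (v i) *+ (N - m1 i))%MM k +
     \sum_i mlead (v i) k * (m1 i + m2 i))%N.
  move=> m1p; rewrite -!big_split; apply: eq_bigr => i _ /=.
  by rewrite !mnmDE !mulmnE; have := ltN m1 i m1p; nia.
apply: (@addIn (\sum_i mlead (v i) k * N)).
rewrite !shift // lead_eq; congr (_ + _)%N.
by apply: eq_bigr => i _; rewrite addnC.
Qed.

End LeadingMonomials.

(** * Isomorphic function fields *)

Section Transfer.
Variables (K L : fieldType) (j : {rmorphism K -> L}) (n : nat).

(* The graph of the K-isomorphism K(t) -> K(t') sending each t i to t' i, when
   t and t' satisfy the same polynomial relations over K. *)
Definition corresponds (t t' : 'I_n -> L) (x y : L) : Prop :=
  exists f g : {mpoly K[n]},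
    [/\ mmap j t g != 0, mmap j t' g != 0,
        x = mmap j t f / mmap j t g & y = mmap j t' f / mmap j t' g].

Lemma corresponds_sym (t t' : 'I_n -> L) (x y : L) :
  corresponds t t' x y -> corresponds t' t y x.
Proof. by case=> f [g []]; exists f, g. Qed.

Section SameRelations.
Variables (t t' : 'I_n -> L).
Hypothesis same_rel : forall f : {mpoly K[n]}, mmap j t f = 0 <-> mmap j t' f = 0.

Lemma corresponds_base (k : K) : corresponds t t' (j k) (j k).
Proof.
by exists k%:MP, 1; rewrite !(rmorph1 (mmap j _)) !mmapC !divr1 oner_neq0.
Qed.

Lemma corresponds_gen (i : 'I_n) : corresponds t t' (t i) (t' i).
Proof.
by exists 'X_i, 1; rewrite !(rmorph1 (mmap j _)) !mmapX !mmap1U !divr1 oner_neq0.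
Qed.

Lemma corresponds_add (x x' y y' : L) : corresponds t t' x x' ->
  corresponds t t' y y' -> corresponds t t' (x + y) (x' + y').
Proof.
case=> f1 [g1 [n1 n1' -> ->]] [f2 [g2 [n2 n2' -> ->]]].
exists (f1 * g2 + f2 * g1), (g1 * g2).
rewrite !(rmorphD (mmap j _)) !(rmorphM (mmap j _)) /= !mulf_neq0 //.
by rewrite !addf_div.
Qed.

Lemma corresponds_opp (x x' : L) :
  corresponds t t' x x' -> corresponds t t' (- x) (- x').
Proof.
case=> f1 [g1 [n1 n1' -> ->]]; exists (- f1), g1.
by rewrite !(rmorphN (mmap j _)) !mulNr.
Qed.

Lemma corresponds_mul (x x' y y' : L) : corresponds t t' x x' ->
  corresponds t t' y y' -> corresponds t t' (x * y) (x' * y').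
Proof.
case=> f1 [g1 [n1 n1' -> ->]] [f2 [g2 [n2 n2' -> ->]]].
exists (f1 * f2), (g1 * g2).
by rewrite !(rmorphM (mmap j _)) /= !mulf_neq0 // !mulf_div.
Qed.

Lemma corresponds_eq0 (x x' : L) : corresponds t t' x x' -> (x == 0) = (x' == 0).
Proof.
case=> f1 [g1 [n1 n1' -> ->]]; rewrite !mulf_eq0 !invr_eq0.
rewrite (negPf n1) (negPf n1') !orbF; apply/eqP/eqP; by move/same_rel.
Qed.

Lemma corresponds_inv (x x' : L) :
  corresponds t t' x x' -> corresponds t t' x^-1 x'^-1.
Proof.
move=> xx'; have := corresponds_eq0 xx'; case: xx' => f [g [ng ng' xE x'E]].
have [-> /esym/eqP->|x0 /esym x0'] := eqVneq x 0.
  by rewrite !invr0 -(rmorph0 j); apply: corresponds_base.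
exists g, f; rewrite xE x'E !invf_div; split=> //.
- by apply: contra_neq x0 => f0; rewrite xE f0 mul0r.
- by apply: contraFneq x0' => f0; rewrite x'E f0 mul0r.
Qed.

Lemma corresponds_fun (x y y' : L) :
  corresponds t t' x y -> corresponds t t' x y' -> y = y'.
Proof.
move=> xy /corresponds_opp xy'; have := corresponds_eq0 (corresponds_add xy xy').
by rewrite subrr eqxx => /esym; rewrite subr_eq0 => /eqP.
Qed.

Lemma corresponds_mmap (m : nat) (u u' : 'I_m -> L) (p : {mpoly K[m]}) :
  (forall i, corresponds t t' (u i) (u' i)) ->
  corresponds t t' (mmap j u p) (mmap j u' p).
Proof.
move=> uu'; rewrite /mmap.
apply: (big_ind2 (corresponds t t')) => [|x x' y y'|q _].
- by rewrite -(rmorph0 j); apply: corresponds_base.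
- exact: corresponds_add.
apply: corresponds_mul; first exact: corresponds_base.
apply: (big_ind2 (corresponds t t')) => [|x x' y y'|i _].
- by rewrite -(rmorph1 j); apply: corresponds_base.
- exact: corresponds_mul.
elim: (q i) => [|d IHd].
  by rewrite !expr0 -(rmorph1 j); apply: corresponds_base.
by rewrite !exprS; apply: corresponds_mul.
Qed.

Lemma corresponds_adjoin (x : L) :
  adjoin j (range t) x -> exists y, corresponds t t' x y.
Proof.
elim=> [k|_ [i ->]|y z _ [y' ?] _ [z' ?]|y _ [y' ?]|y z _ [y' ?] _ [z' ?]|y _ [y' ?]].
- by exists (j k); apply: corresponds_base.
- by exists (t' i); apply: corresponds_gen.
- by exists (y' + z'); apply: corresponds_add.
- by exists (- y'); apply: corresponds_opp.
- by exists (y' * z'); apply: corresponds_mul.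
- by exists y'^-1; apply: corresponds_inv.
Qed.

Lemma adjoin_corresponds (x y : L) : corresponds t t' x y -> adjoin j (range t) x.
Proof.
have gen_t i : adjoin j (range t) (t i) by apply: adjoin_mem; exists i.
by case=> f [g [_ _ -> _]]; apply: adjoin_mul; [|apply: adjoin_inv]; apply: adjoin_mmap.
Qed.

End SameRelations.

Lemma purely_transcendental_transfer (t t' : 'I_n -> L) :
    (forall f : {mpoly K[n]}, mmap j t f = 0 <-> mmap j t' f = 0) ->
  purely_transcendental j (adjoin j (range t)) ->
  purely_transcendental j (adjoin j (range t')).
Proof.
move=> same_rel [B [B_ind BE]].
have same_rel' f : mmap j t' f = 0 <-> mmap j t f = 0.
  by split=> /same_rel.
exists (fun y => exists2 x, B x & corresponds t t' x y); split.
  move=> m u' u'_inj u'B p pu'0.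
  have u_ex i : exists x, B x /\ corresponds t t' x (u' i).
    by have [x] := u'B i; exists x.
  have [u uE] := fin_all_exists u_ex.
  apply: (B_ind _ u) => [i i' uii'|i|].
  - have [_ ui] := uE i; have [_ ui'] := uE i'.
    by apply: u'_inj; apply: (corresponds_fun same_rel ui); rewrite uii'.
  - by case: (uE i).
  have : corresponds t t' (mmap j u p) (mmap j u' p).
    by apply: corresponds_mmap => i; case: (uE i).
  by move/(corresponds_eq0 same_rel); rewrite pu'0 eqxx => /eqP.
move=> y; split=> [/(corresponds_adjoin same_rel')[x /corresponds_sym xy]|].
  have /BE := adjoin_corresponds xy.
  move=> Bx; elim: Bx y xy => {x} [k|x Bx|x z Bx IHx Bz IHz|x Bx IHx|
      x z Bx IHx Bz IHz|x Bx IHx] y xy.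
  - by rewrite (corresponds_fun same_rel xy (corresponds_base t t' k)); apply: adjoin_base.
  - by apply: adjoin_mem; exists x.
  - have [x' xx'] := corresponds_adjoin same_rel (proj2 (BE x) Bx).
    have [z' zz'] := corresponds_adjoin same_rel (proj2 (BE z) Bz).
    rewrite (corresponds_fun same_rel xy (corresponds_add xx' zz')).
    by apply: adjoin_add; [apply: IHx | apply: IHz].
  - have [x' xx'] := corresponds_adjoin same_rel (proj2 (BE x) Bx).
    rewrite (corresponds_fun same_rel xy (corresponds_opp xx')).
    by apply/adjoin_opp/IHx.
  - have [x' xx'] := corresponds_adjoin same_rel (proj2 (BE x) Bx).
    have [z' zz'] := corresponds_adjoin same_rel (proj2 (BE z) Bz).
    rewrite (corresponds_fun same_rel xy (corresponds_mul xx' zz')).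
    by apply: adjoin_mul; [apply: IHx | apply: IHz].
  - have [x' xx'] := corresponds_adjoin same_rel (proj2 (BE x) Bx).
    rewrite (corresponds_fun same_rel xy (corresponds_inv same_rel xx')).
    by apply/adjoin_inv/IHx.
apply: adjoin_sub => {}y [x _ /corresponds_sym]; exact: adjoin_corresponds.
Qed.

End Transfer.

Definition quadruple (T : Type) (p w r q : T) (i : 'I_4) : T :=
  nth p [:: p; w; r; q] i.

Section DoubleCover.
Variables (K L : fieldType) (j : {rmorphism K -> L}) (a b c : K).

Definition on_cover (p w r q : L) : Prop :=
  q ^+ 2 * (r ^+ 2 - j c) = (p ^+ 2 - j a) * (w ^+ 2 - j b).

Definition independent3 (p w r : L) : Prop :=
  forall f : {mpoly K[3]}, mmap j (triple p w r) f = 0 -> f = 0.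

(* For independent [p, w, r] this means that [q] does not lie in [K(p, w, r)]. *)
Definition irrational (p w r q : L) : Prop :=
  forall f g : {mpoly K[3]},
  mmap j (triple p w r) f + mmap j (triple p w r) g * q = 0 -> g = 0.

Let X : {mpoly K[3]} := 'X_(@Ordinal 3 0 isT).
Let Y : {mpoly K[3]} := 'X_(@Ordinal 3 1 isT).
Let Z : {mpoly K[3]} := 'X_(@Ordinal 3 2 isT).

Let evX p w r : mmap j (triple p w r) X = p.
Proof. by rewrite mmapX mmap1U. Qed.
Let evY p w r : mmap j (triple p w r) Y = w.
Proof. by rewrite mmapX mmap1U. Qed.
Let evZ p w r : mmap j (triple p w r) Z = r.
Proof. by rewrite mmapX mmap1U. Qed.

Let evXa p w r : mmap j (triple p w r) (X ^+ 2 - a%:MP) = p ^+ 2 - j a.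
Proof. by rewrite (rmorphB (mmap j _)) (rmorphXn (mmap j _)) /= evX mmapC. Qed.
Let evYb p w r : mmap j (triple p w r) (Y ^+ 2 - b%:MP) = w ^+ 2 - j b.
Proof. by rewrite (rmorphB (mmap j _)) (rmorphXn (mmap j _)) /= evY mmapC. Qed.
Let evZc p w r : mmap j (triple p w r) (Z ^+ 2 - c%:MP) = r ^+ 2 - j c.
Proof. by rewrite (rmorphB (mmap j _)) (rmorphXn (mmap j _)) /= evZ mmapC. Qed.

Lemma independent3_sqr_neq (p w r : L) : independent3 p w r -> r ^+ 2 - j c != 0.
Proof.
move=> ind; rewrite -(evZc p w r); apply/eqP => /ind.
move=> /(congr1 (mcoeff (U_(@Ordinal 3 2 isT) *+ 2))).
rewrite mcoeff0 mcoeffB mcoeffC /Z mpolyXn mcoeffX eqxx.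
case: eqP => [/(congr1 (fun m : 'X_{1..3} => m (@Ordinal 3 2 isT)))|_].
  by rewrite mulmnE mnm1E mnm0E.
by rewrite mulr0 subr0; apply/eqP/oner_neq0.
Qed.

(* Irrationality of any one solution says that
   (X^2 - a)(Y^2 - b)(Z^2 - c) is not a square in K(X, Y, Z). *)
Lemma irrational_transfer (p w r q p' w' r' q' : L) :
    on_cover p w r q -> independent3 p w r ->
    on_cover p' w' r' q' -> independent3 p' w' r' ->
  irrational p w r q -> irrational p' w' r' q'.
Proof.
move=> cov ind cov' ind' irr f g fg0.
have ev_sqr t (f1 f2 : {mpoly K[3]}) :
    mmap j t (f1 ^+ 2 * f2) = mmap j t f1 ^+ 2 * mmap j t f2.
  by rewrite (rmorphM (mmap j t)) (rmorphXn (mmap j t)).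
have rel : f ^+ 2 * (Z ^+ 2 - c%:MP)
         = g ^+ 2 * ((X ^+ 2 - a%:MP) * (Y ^+ 2 - b%:MP)).
  apply/eqP; rewrite -subr_eq0; apply/eqP/ind'.
  rewrite (rmorphB (mmap j _)) /= !ev_sqr (rmorphM (mmap j _)) /=.
  rewrite evXa evYb evZc -cov'; move/eqP: fg0; rewrite addr_eq0 => /eqP ->.
  by ring.
have /eqP : mmap j (triple p w r) f ^+ 2 = (mmap j (triple p w r) g * q) ^+ 2.
  apply: (mulIf (independent3_sqr_neq ind)); rewrite exprMn -[RHS]mulrA cov.
  move/(congr1 (mmap j (triple p w r))): rel.
  by rewrite !ev_sqr (rmorphM (mmap j _)) /= evXa evYb evZc.
rewrite eqf_sqr => /orP[] /eqP fE; last by apply: (irr f); rewrite fE addNr.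
by apply: (irr (- f)); rewrite (rmorphN (mmap j _)) /= fE addNr.
Qed.

Lemma cover_reduction (f : {mpoly K[4]}) :
  exists (N : nat) (A B : {mpoly K[3]}), forall p w r q, on_cover p w r q ->
    mmap j (quadruple p w r q) f * (r ^+ 2 - j c) ^+ N =
    mmap j (triple p w r) A + mmap j (triple p w r) B * q.
Proof.
pose P f := exists (N : nat) (A B : {mpoly K[3]}), forall p w r q,
    on_cover p w r q -> mmap j (quadruple p w r q) f * (r ^+ 2 - j c) ^+ N =
    mmap j (triple p w r) A + mmap j (triple p w r) B * q.
rewrite -/(P f).
have PC k : P k%:MP.
  by exists 0%N, k%:MP, 0 => p w r q _; rewrite !mmapC raddf0 mul0r addr0 mulr1.
have evM t (f1 : {mpoly K[3]}) N :
    mmap j t (f1 * (Z ^+ 2 - c%:MP) ^+ N)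
    = mmap j t f1 * mmap j t (Z ^+ 2 - c%:MP) ^+ N.
  by rewrite (rmorphM (mmap j t)) (rmorphXn (mmap j t)).
have PD f1 f2 : P f1 -> P f2 -> P (f1 + f2).
  move=> [N1 [A1 [B1 E1]]] [N2 [A2 [B2 E2]]].
  exists (N1 + N2)%N, (A1 * (Z ^+ 2 - c%:MP) ^+ N2 + A2 * (Z ^+ 2 - c%:MP) ^+ N1),
    (B1 * (Z ^+ 2 - c%:MP) ^+ N2 + B2 * (Z ^+ 2 - c%:MP) ^+ N1) => p w r q cov.
  rewrite !(rmorphD (mmap j _)) /= !evM evZc exprD.
  have E1' := E1 p w r q cov; have E2' := E2 p w r q cov.
  set D := r ^+ 2 - j c in E1' E2' *.
  transitivity (mmap j (quadruple p w r q) f1 * D ^+ N1 * D ^+ N2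
              + mmap j (quadruple p w r q) f2 * D ^+ N2 * D ^+ N1); first by ring.
  by rewrite E1' E2'; ring.
have evA t (f1 f2 f3 f4 u v : {mpoly K[3]}) :
    mmap j t (f1 * f2 * u + f3 * f4 * v)
    = mmap j t f1 * mmap j t f2 * mmap j t u + mmap j t f3 * mmap j t f4 * mmap j t v.
  by rewrite (rmorphD (mmap j t)) !(rmorphM (mmap j t)).
have evB t (f1 f2 f3 f4 u : {mpoly K[3]}) :
    mmap j t ((f1 * f2 + f3 * f4) * u)
    = (mmap j t f1 * mmap j t f2 + mmap j t f3 * mmap j t f4) * mmap j t u.
  by rewrite (rmorphM (mmap j t)) (rmorphD (mmap j t)) !(rmorphM (mmap j t)).
have PM f1 f2 : P f1 -> P f2 -> P (f1 * f2).
  move=> [N1 [A1 [B1 E1]]] [N2 [A2 [B2 E2]]].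
  exists (N1 + N2).+1,
    (A1 * A2 * (Z ^+ 2 - c%:MP) + B1 * B2 * ((X ^+ 2 - a%:MP) * (Y ^+ 2 - b%:MP))),
    ((A1 * B2 + B1 * A2) * (Z ^+ 2 - c%:MP)) => p w r q cov.
  rewrite evA evB !(rmorphM (mmap j _)) /= evXa evYb evZc -cov exprS exprD.
  have E1' := E1 p w r q cov; have E2' := E2 p w r q cov.
  set D := r ^+ 2 - j c in E1' E2' *.
  transitivity (D * (mmap j (quadruple p w r q) f1 * D ^+ N1)
                  * (mmap j (quadruple p w r q) f2 * D ^+ N2)); first by ring.
  by rewrite E1' E2'; ring.
have PX i : P 'X_i.
  case: i => [[|[|[|[|//]]]] hi].
  - by exists 0%N, X, 0 => p w r q _; rewrite evX raddf0 mul0r addr0 mulr1 mmapX mmap1U.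
  - by exists 0%N, Y, 0 => p w r q _; rewrite evY raddf0 mul0r addr0 mulr1 mmapX mmap1U.
  - by exists 0%N, Z, 0 => p w r q _; rewrite evZ raddf0 mul0r addr0 mulr1 mmapX mmap1U.
  exists 0%N, 0, 1 => p w r q _.
  by rewrite raddf0 (rmorph1 (mmap j _)) mul1r add0r mulr1 mmapX mmap1U.
elim/mpolyind: f => [|k m g _ _ IHg]; first by have := PC 0; rewrite mpolyC0.
apply: (PD _ _ _ IHg); rewrite -mul_mpolyC; apply: (PM _ _ (PC k)); rewrite mpolyXE_id.
have P1 : P 1 by have := PC 1; rewrite mpolyC1.
apply: (big_ind P P1 PM) => i _; elim: (m i) => [|d IHd]; first by rewrite expr0.
by rewrite exprS; apply: PM.
Qed.

Lemma cover_same_relations (p w r q p' w' r' q' : L) :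
    on_cover p w r q -> independent3 p w r -> irrational p w r q ->
    on_cover p' w' r' q' -> independent3 p' w' r' ->
  forall f : {mpoly K[4]}, mmap j (quadruple p w r q) f = 0 ->
  mmap j (quadruple p' w' r' q') f = 0.
Proof.
move=> cov ind irr cov' ind' f f0; have [N [A [B E]]] := cover_reduction f.
have := E _ _ _ _ cov; rewrite f0 mul0r => /esym AB0.
have B0 := irr _ _ AB0; move: AB0; rewrite B0 raddf0 mul0r addr0 => /ind A0.
have := E _ _ _ _ cov'; rewrite A0 B0 !raddf0 mul0r addr0 => /eqP.
rewrite mulf_eq0 expf_eq0 (negPf (independent3_sqr_neq ind')) andbF orbF.
by move/eqP.
Qed.

End DoubleCover.

(** * Identities for inversions *)

Definition tr (F : fieldType) (k x : F) : F := x + k / x.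
Definition df (F : fieldType) (k x : F) : F := x - k / x.

Section Inversion.
Variables (F : fieldType) (k x : F).

Lemma tr_inversion : k != 0 -> x != 0 -> tr k (k / x) = tr k x.
Proof. by move=> k0 x0; rewrite /tr; field; rewrite k0 x0. Qed.

Lemma df_inversion : k != 0 -> x != 0 -> df k (k / x) = - df k x.
Proof. by move=> k0 x0; rewrite /df; field; rewrite k0 x0. Qed.

Lemma tr_opp : tr k (- x) = - tr k x.
Proof. by rewrite /tr invrN mulrN opprD. Qed.

Lemma df_opp : df k (- x) = - df k x.
Proof. by rewrite /df invrN mulrN opprD. Qed.

Lemma tr_df_half : 2%:R != 0 :> F -> x = (tr k x + df k x) / 2%:R.
Proof. by move=> two0; rewrite /tr /df addrACA subrr addr0 -mulr2n -(mulr_natr x) mulfK. Qed.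

Lemma df_sqr : x != 0 -> df k x ^+ 2 = tr k x ^+ 2 - 4%:R * k.
Proof. by move=> x0; rewrite /tr /df; field. Qed.

Variable s : {rmorphism F -> F}.

Lemma rmorph_tr : s k = k -> s (tr k x) = tr k (s x).
Proof. by move=> sk; rewrite /tr rmorphD fmorph_div sk. Qed.

Lemma rmorph_df : s k = k -> s (df k x) = df k (s x).
Proof. by move=> sk; rewrite /df rmorphB fmorph_div sk. Qed.

End Inversion.

Section InvariantsOfTwoInversions.
Variables (F : fieldType) (a b x y : F).
Hypotheses (x0 : x != 0) (y0 : y != 0).
Hypotheses (xa : df a x != 0) (yb : df b y != 0).
Hypothesis (xyab : df (a * b) (x * y) != 0).
Let u := df a x / df (a * b) (x * y).
Let v := df b y / df (a * b) (x * y).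

Let xa' : x * x - a != 0.
Proof.
apply: contra_neq xa => /eqP; rewrite subr_eq0 => /eqP <-.
by rewrite /df mulfK // subrr.
Qed.
Let yb' : y * y - b != 0.
Proof.
apply: contra_neq yb => /eqP; rewrite subr_eq0 => /eqP <-.
by rewrite /df mulfK // subrr.
Qed.
Let xyab' : x * y * (x * y) - a * b != 0.
Proof.
apply: contra_neq xyab => /eqP; rewrite subr_eq0 => /eqP <-.
by rewrite /df mulfK ?subrr // mulf_neq0.
Qed.

Lemma inversion_tr1 : tr a x = (1 - b * u ^+ 2 + a * v ^+ 2) / v.
Proof. by rewrite /u /v /tr /df; field; rewrite x0 y0 yb' xyab'. Qed.

Lemma inversion_tr2 : tr b y = (1 + b * u ^+ 2 - a * v ^+ 2) / u.
Proof. by rewrite /u /v /tr /df; field; rewrite x0 y0 xa' xyab'. Qed.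

Lemma inversion_df2 : df b y = df a x * v / u.
Proof. by rewrite /u /v /tr /df; field; rewrite x0 y0 xa' xyab'. Qed.

End InvariantsOfTwoInversions.

Section CoverIdentities.
Variables (F : fieldType) (a b c x y z : F).
Hypothesis two0 : 2%:R != 0 :> F.
Hypotheses (x0 : x != 0) (y0 : y != 0) (z0 : z != 0).

Section Source.
Let P1 := tr a x.
Let M1 := df a x.
Let P2 := tr b y.
Let M2 := df b y.
Let P3 := tr c z.
Let M3 := df c z.
Let d := M1 * P2 - P1 * M2.
Hypotheses (P30 : P3 != 0) (d0 : d != 0).
Let p := M3 * P1 / (2%:R * P3).
Let w := M3 * P2 / (2%:R * P3).
Let r := (P3 ^+ 2 * (M1 * M2) - 4%:R * c * (P1 * P2)) / (2%:R * (P3 * d)).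
Let q := d / (2%:R * P3).

Let M3E : M3 ^+ 2 = P3 ^+ 2 - 4%:R * c.
Proof. exact: df_sqr. Qed.
Let M1E : M1 ^+ 2 = P1 ^+ 2 - 4%:R * a.
Proof. exact: df_sqr. Qed.
Let M2E : M2 ^+ 2 = P2 ^+ 2 - 4%:R * b.
Proof. exact: df_sqr. Qed.
Let four0 : 4%:R != 0 :> F.
Proof. by rewrite (natrM F 2 2) mulf_neq0. Qed.

Lemma source_cover :
  q ^+ 2 * (r ^+ 2 - c) = (p ^+ 2 - a) * (w ^+ 2 - b).
Proof.
have pE : p ^+ 2 - a = (M1 ^+ 2 - 4%:R * c * P1 ^+ 2 / P3 ^+ 2) / 4%:R.
  by rewrite M1E /p !expr_div_n exprMn M3E; field; rewrite four0 P30 two0.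
have wE : w ^+ 2 - b = (M2 ^+ 2 - 4%:R * c * P2 ^+ 2 / P3 ^+ 2) / 4%:R.
  by rewrite M2E /w !expr_div_n exprMn M3E; field; rewrite four0 P30 two0.
rewrite pE wE /q /r; move: d0; rewrite /d.
generalize P1 M1 P2 M2 P3 P30 => A1 B1 A2 B2 A3 A30 dn0.
by field; rewrite ?A30 ?dn0 ?four0 ?two0.
Qed.

Lemma source_ratio : b * x / y = p * w - r * q + q * (P3 / 2%:R).
Proof.
have -> : b * x / y = (P1 * P2 - M1 * M2) / 4%:R + d / 4%:R.
  by rewrite /d /P1 /P2 /M1 /M2 /tr /df; field; rewrite ?x0 ?y0 ?four0.
have -> : p * w = (P3 ^+ 2 - 4%:R * c) * (P1 * P2) / (4%:R * P3 ^+ 2).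
  by rewrite -M3E /p /w; field; rewrite ?P30 ?four0 ?two0.
rewrite /r /q; move: d0; rewrite /d.
generalize P1 M1 P2 M2 P3 P30 => A1 B1 A2 B2 A3 A30 dn0.
by field; rewrite ?A30 ?dn0 ?four0 ?two0.
Qed.

Lemma source_sqr :
  P3 ^+ 2 = 4%:R * ((p * w - r * q) ^+ 2 - a * b) / q ^+ 2.
Proof.
have -> : p * w - r * q = b * x / y - d / 4%:R.
  by rewrite source_ratio /q; field; rewrite ?P30 ?four0 ?two0.
move: d0 P30; rewrite /q /d /P1 /M1 /P2 /M2 /tr /df; generalize P3 => A3 dn0 A30.
have e0 : (x * x - a) * (y * y + b) - (x * x + a) * (y * y - b) != 0.
  by apply: contra_neq dn0 => e; rewrite -(mul0r (x * y)^-1) -e; field; rewrite x0 y0.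
by field; rewrite ?x0 ?y0 ?e0 ?A30 ?four0 ?two0.
Qed.

Lemma source_product :
  y * M3 / 2%:R = r * w - p * (w ^+ 2 - b) / q + w * (P3 / 2%:R).
Proof.
have wE : w ^+ 2 - b = (M2 ^+ 2 - 4%:R * c * P2 ^+ 2 / P3 ^+ 2) / 4%:R.
  by rewrite M2E /w !expr_div_n exprMn M3E; field; rewrite four0 P30 two0.
have -> : y = (P2 + M2) / 2%:R by apply: tr_df_half.
rewrite wE /r /w /p /q; move: d0; rewrite /d.
generalize P1 M1 P2 M2 P3 P30 => A1 B1 A2 B2 A3 A30 dn0.
by field; rewrite ?A30 ?dn0 ?four0 ?two0.
Qed.

Lemma source_den : d = 2%:R * (b * (x / y)) - 2%:R * (a * (y / x)).
Proof. by rewrite /d /P1 /P2 /M1 /M2 /tr /df; field; rewrite ?x0 ?y0. Qed.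

End Source.

Section Target.
Hypothesis (ya : df a y != 0).
Let N := - b * x ^+ 2 + c.
Let p := tr a y / 2%:R.
Let q := df a y / (2%:R * x).
Let r := tr N z / 2%:R.
Let w := df N z / (2%:R * x).

Lemma target_cover :
  q ^+ 2 * (r ^+ 2 - c) = (p ^+ 2 - a) * (w ^+ 2 - b).
Proof. by rewrite /p /q /r /w /N /tr /df; field; rewrite x0 y0 z0 two0. Qed.

Lemma target_sqr : x ^+ 2 = (p ^+ 2 - a) / q ^+ 2.
Proof.
have ya' : y * y - a != 0.
  by apply: contra_neq ya => /eqP; rewrite subr_eq0 => /eqP <-; rewrite /df mulfK // subrr.
by rewrite /p /q /tr /df; field; rewrite ?x0 ?y0 ?ya' ?two0.
Qed.

Lemma target_x2 : y = p + q * x.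
Proof. by rewrite /p /q /tr /df; field; rewrite x0 y0 two0. Qed.

Lemma target_x3 : z = r + w * x.
Proof. by rewrite /r /w /tr /df; field; rewrite x0 z0 two0. Qed.

End Target.

End CoverIdentities.

Definition mnm3 (k1 k2 k3 : nat) : 'X_{1..3} :=
  (U_(@Ordinal 3 0 isT) *+ k1 + U_(@Ordinal 3 1 isT) *+ k2
   + U_(@Ordinal 3 2 isT) *+ k3)%MM.

Lemma mnm3E (k1 k2 k3 : nat) (i : 'I_3) : mnm3 k1 k2 k3 i = nth 0%N [:: k1; k2; k3] i.
Proof.
rewrite /mnm3 !mnmDE !mulmnE !mnm1E.
by case: i => [[|[|[|//]]] hi]; rewrite /= ?muln0 ?muln1 ?mul0n ?mul1n ?addn0.
Qed.

Lemma mnm3_add (k1 k2 k3 l1 l2 l3 : nat) :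
  (mnm3 k1 k2 k3 + mnm3 l1 l2 l3)%MM = mnm3 (k1 + l1) (k2 + l2) (k3 + l3).
Proof.
by apply/mnmP => i; rewrite mnmDE !mnm3E; case: i => [[|[|[|//]]] hi].
Qed.

Lemma mdeg_mnm3 (k1 k2 k3 : nat) : mdeg (mnm3 k1 k2 k3) = (k1 + k2 + k3)%N.
Proof. by rewrite /mnm3 !mdegD !mdegMn !mdeg1 !mul1n. Qed.

Section Leads.
Variable K : fieldType.
Implicit Types f g : ratfun K 3.

(* The leading exponent of f, as the difference of two multidegrees. *)
Definition has_lead f (k1 k2 k3 l1 l2 l3 : nat) : Prop :=
  exists n d : {mpoly K[3]},
    [/\ n != 0, d != 0, f = FracField.tofrac n / FracField.tofrac d,
        mlead n = mnm3 k1 k2 k3 & mlead d = mnm3 l1 l2 l3].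

Lemma has_lead_neq0 f k1 k2 k3 l1 l2 l3 : has_lead f k1 k2 k3 l1 l2 l3 -> f != 0.
Proof.
by case=> n [d [n0 d0 -> _ _]]; rewrite mulf_neq0 ?invr_eq0 // tofrac_eq0.
Qed.

Lemma has_lead_C (k : K) : k != 0 -> has_lead (ratC K 3 k) 0 0 0 0 0 0.
Proof.
move=> k0; exists k%:MP, 1; rewrite mpolyC_eq0 k0 oner_neq0 rmorph1 divr1.
by rewrite mleadC mlead1; split=> //; apply/mnmP => i; rewrite mnm3E mnm0E;
  case: i => [[|[|[|//]]] hi].
Qed.

Lemma has_lead_X (i : 'I_3) : has_lead (ratX K i) (i == 0 :> nat) (i == 1 :> nat)
  (i == 2 :> nat) 0 0 0.
Proof.
have X0 : 'X_i != 0 :> {mpoly K[3]}.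
  by have := ratX_neq0 K i; rewrite tofrac_eq0.
exists 'X_i, 1; rewrite X0 oner_neq0 rmorph1 divr1 mleadXm mlead1; split=> //;
  apply/mnmP => k; rewrite mnm3E ?mnm0E ?mnm1E //; last by case: k => [[|[|[|//]]] hi].
by case: k i {X0} => [[|[|[|//]]] hi] [[|[|[|//]]] hi'].
Qed.

Lemma has_lead_mul f g k1 k2 k3 l1 l2 l3 k1' k2' k3' l1' l2' l3' :
    has_lead f k1 k2 k3 l1 l2 l3 -> has_lead g k1' k2' k3' l1' l2' l3' ->
  has_lead (f * g) (k1 + k1') (k2 + k2') (k3 + k3') (l1 + l1') (l2 + l2') (l3 + l3').
Proof.
move=> [n [d [n0 d0 -> ln ld]]] [n' [d' [n0' d0' -> ln' ld']]].
exists (n * n'), (d * d'); rewrite !mulf_neq0 // !mleadM // ln ld ln' ld' !mnm3_add.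
by split=> //; rewrite mulf_div -!rmorphM.
Qed.

Lemma has_lead_inv f k1 k2 k3 l1 l2 l3 :
  has_lead f k1 k2 k3 l1 l2 l3 -> has_lead f^-1 l1 l2 l3 k1 k2 k3.
Proof. by case=> n [d [n0 d0 -> ln ld]]; exists d, n; rewrite invf_div. Qed.

Lemma has_lead_opp f k1 k2 k3 l1 l2 l3 :
  has_lead f k1 k2 k3 l1 l2 l3 -> has_lead (- f) k1 k2 k3 l1 l2 l3.
Proof.
by case=> n [d [n0 d0 -> ln ld]]; exists (- n), d; rewrite oppr_eq0 mleadN rmorphN mulNr.
Qed.

Lemma has_lead_add_lt f g k1 k2 k3 l1 l2 l3 k1' k2' k3' l1' l2' l3' :
    has_lead f k1 k2 k3 l1 l2 l3 -> has_lead g k1' k2' k3' l1' l2' l3' ->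
    (mnm3 (k1' + l1) (k2' + l2) (k3' + l3) < mnm3 (k1 + l1') (k2 + l2') (k3 + l3'))%O ->
  has_lead (f + g) (k1 + l1') (k2 + l2') (k3 + l3') (l1 + l1') (l2 + l2') (l3 + l3').
Proof.
move=> [n [d [n0 d0 -> ln ld]]] [n' [d' [n0' d0' -> ln' ld']]] lt.
have lead_eq : mlead (n * d' + n' * d) = mnm3 (k1 + l1') (k2 + l2') (k3 + l3').
  have ln_d' : mlead (n * d') = mnm3 (k1 + l1') (k2 + l2') (k3 + l3').
    by rewrite mleadM // ln ld' mnm3_add.
  by rewrite mleadDl ln_d' // mleadM // ln' ld mnm3_add.
exists (n * d' + n' * d), (d * d'); rewrite lead_eq mulf_neq0 // mleadM // ld ld' mnm3_add.
split=> //; last by rewrite addf_div ?tofrac_eq0 // -!rmorphM -rmorphD.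
apply/eqP => n_eq0; move: lt; rewrite -lead_eq n_eq0 mlead0.
by rewrite Order.TotalTheory.ltNge le0m.
Qed.

Lemma has_lead_add f g k1 k2 k3 l1 l2 l3 k1' k2' k3' l1' l2' l3' :
    has_lead f k1 k2 k3 l1 l2 l3 -> has_lead g k1' k2' k3' l1' l2' l3' ->
    (k1' + l1 + (k2' + l2) + (k3' + l3) < k1 + l1' + (k2 + l2') + (k3 + l3'))%N ->
  has_lead (f + g) (k1 + l1') (k2 + l2') (k3 + l3') (l1 + l1') (l2 + l2') (l3 + l3').
Proof.
move=> lf lg lt; apply: has_lead_add_lt lf lg _.
by apply: lt_mdeg_ltmc; rewrite !mdeg_mnm3.
Qed.

Lemma has_lead_add_neq f g k1 k2 k3 l1 l2 l3 k1' k2' k3' l1' l2' l3' :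
    has_lead f k1 k2 k3 l1 l2 l3 -> has_lead g k1' k2' k3' l1' l2' l3' ->
    [|| k1' + l1 != k1 + l1', k2' + l2 != k2 + l2' | k3' + l3 != k3 + l3']%N ->
  has_lead (f + g) (k1 + l1') (k2 + l2') (k3 + l3') (l1 + l1') (l2 + l2') (l3 + l3') \/
  has_lead (f + g) (k1' + l1) (k2' + l2) (k3' + l3) (l1' + l1) (l2' + l2) (l3' + l3).
Proof.
move=> lf lg neq.
have [lt|lt|eqm] := Order.TotalTheory.ltgtP
    (mnm3 (k1' + l1) (k2' + l2) (k3' + l3)) (mnm3 (k1 + l1') (k2 + l2') (k3 + l3')).
- by left; apply: has_lead_add_lt lf lg lt.
- by right; rewrite addrC; apply: has_lead_add_lt lg lf lt.
have eqi (i : 'I_3) := congr1 (fun m : 'X_{1..3} => m i) eqm.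
move: neq (eqi (@Ordinal 3 0 isT)) (eqi (@Ordinal 3 1 isT)) (eqi (@Ordinal 3 2 isT)).
by rewrite !mnm3E /= => neq e1 e2 e3; rewrite e1 e2 e3 !eqxx in neq.
Qed.

Lemma has_lead_independent f1 f2 f3
    k11 k12 k13 l11 l12 l13 k21 k22 k23 l21 l22 l23 k31 k32 k33 l31 l32 l33 :
    has_lead f1 k11 k12 k13 l11 l12 l13 -> has_lead f2 k21 k22 k23 l21 l22 l23 ->
    has_lead f3 k31 k32 k33 l31 l32 l33 ->
    (forall m1 m2 m3 m1' m2' m3',
      [/\ k11 * m1 + l11 * m1' + (k21 * m2 + l21 * m2') + (k31 * m3 + l31 * m3')
        = k11 * m1' + l11 * m1 + (k21 * m2' + l21 * m2) + (k31 * m3' + l31 * m3),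
          k12 * m1 + l12 * m1' + (k22 * m2 + l22 * m2') + (k32 * m3 + l32 * m3')
        = k12 * m1' + l12 * m1 + (k22 * m2' + l22 * m2) + (k32 * m3' + l32 * m3) &
          k13 * m1 + l13 * m1' + (k23 * m2 + l23 * m2') + (k33 * m3 + l33 * m3')
        = k13 * m1' + l13 * m1 + (k23 * m2' + l23 * m2) + (k33 * m3' + l33 * m3)] ->
      [/\ m1 = m1', m2 = m2' & m3 = m3'])%N ->
  independent3 (ratC K 3) f1 f2 f3.
Proof.
move=> [n1 [d1 [n10 d10 E1 ln1 ld1]]] [n2 [d2 [n20 d20 E2 ln2 ld2]]].
move=> [n3 [d3 [n30 d30 E3 ln3 ld3]]] kl p p0.
apply: (@mlead_independent K 3 (triple n1 n2 n3) (triple d1 d2 d3)).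
- by case=> [[|[|[|//]]] hi].
- by case=> [[|[|[|//]]] hi].
- have o0E : ord0 = @Ordinal 3 0 isT by apply: val_inj.
  have o1E : lift ord0 ord0 = @Ordinal 3 1 isT by apply: val_inj.
  have o2E : lift ord0 (lift ord0 ord0) = @Ordinal 3 2 isT by apply: val_inj.
  move=> m m'; rewrite !big_ord_recl !big_ord0 /triple /= ln1 ln2 ln3 ld1 ld2 ld3.
  move=> /mnmP E; have E1' := E (@Ordinal 3 0 isT); have E2' := E (@Ordinal 3 1 isT).
  have := E (@Ordinal 3 2 isT); move: E1' E2'; clear E.
  rewrite !mnmDE !mnm0E !mulmnE !mnm3E /= !addn0 => e1 e2 e3.
  rewrite o1E o2E o0E !addnA -!addnA in e1 e2 e3.
  have [|F1 F2 F3] := kl (m (@Ordinal 3 0 isT)) (m (@Ordinal 3 1 isT))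
    (m (@Ordinal 3 2 isT)) (m' (@Ordinal 3 0 isT)) (m' (@Ordinal 3 1 isT))
    (m' (@Ordinal 3 2 isT)).
    by rewrite -!addnA.
  by apply/mnmP; case=> [[|[|[|//]]] hi]; rewrite (bool_irrelevance hi isT).
rewrite -p0; apply: eq_mmap => // i; rewrite E1 E2 E3.
by case: i => [[|[|[|//]]] hi].
Qed.

Lemma x1_neq0 : x1 != 0 :> ratfun K 3. Proof. exact: ratX_neq0. Qed.
Lemma x2_neq0 : x2 != 0 :> ratfun K 3. Proof. exact: ratX_neq0. Qed.
Lemma x3_neq0 : x3 != 0 :> ratfun K 3. Proof. exact: ratX_neq0. Qed.

Lemma has_lead_x1 : has_lead (x1 : ratfun K 3) 1 0 0 0 0 0.
Proof. exact: has_lead_X. Qed.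
Lemma has_lead_x2 : has_lead (x2 : ratfun K 3) 0 1 0 0 0 0.
Proof. exact: has_lead_X. Qed.
Lemma has_lead_x3 : has_lead (x3 : ratfun K 3) 0 0 1 0 0 0.
Proof. exact: has_lead_X. Qed.

Lemma has_lead_df (k : K) (f : ratfun K 3) k1 k2 k3 l1 l2 l3 :
    k != 0 -> (l1 + l2 + l3 < k1 + k2 + k3)%N -> has_lead f k1 k2 k3 l1 l2 l3 ->
  has_lead (df k%:K f) (k1 + k1) (k2 + k2) (k3 + k3) (l1 + k1) (l2 + k2) (l3 + k3).
Proof.
move=> k0 lt lf.
apply: has_lead_add lf (has_lead_opp (has_lead_mul (has_lead_C k0) (has_lead_inv lf))) _.
by rewrite !add0n; lia.
Qed.

Lemma has_lead_tr (k : K) (f : ratfun K 3) k1 k2 k3 l1 l2 l3 :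
    k != 0 -> (l1 + l2 + l3 < k1 + k2 + k3)%N -> has_lead f k1 k2 k3 l1 l2 l3 ->
  has_lead (tr k%:K f) (k1 + k1) (k2 + k2) (k3 + k3) (l1 + k1) (l2 + k2) (l3 + k3).
Proof.
move=> k0 lt lf.
apply: has_lead_add lf (has_lead_mul (has_lead_C k0) (has_lead_inv lf)) _.
by rewrite !add0n; lia.
Qed.

End Leads.

(** * Invariant fields *)

Ltac adjoin_closure := repeat match goal with
  | H : ?P |- ?P => exact: H
  | |- adjoin _ _ (_ + _) => apply: adjoin_add
  | |- adjoin _ _ (- _) => apply: adjoin_opp
  | |- adjoin _ _ (_ * _) => apply: adjoin_mul
  | |- adjoin _ _ (_^-1) => apply: adjoin_inv
  | |- adjoin _ _ (_ ^+ _) => apply: adjoin_exp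
  | |- adjoin _ _ (1 *+ _) => apply: adjoin_nat
  | |- adjoin _ _ 1 => apply: (adjoin_nat _ _ 1)
  | |- adjoin _ _ _ => apply: adjoin_base
  end.

Lemma df_sign (F : fieldType) (e k x : F) : e = 1 \/ e = -1 -> df k (e * x) = e * df k x.
Proof. by case=> ->; rewrite ?mul1r // !mulN1r df_opp. Qed.

Lemma tr_sign (F : fieldType) (e k x : F) : e = 1 \/ e = -1 -> tr k (e * x) = e * tr k x.
Proof. by case=> ->; rewrite ?mul1r // !mulN1r tr_opp. Qed.

Lemma range_triple (T : Type) (u1 u2 u3 : T) :
  [/\ range (triple u1 u2 u3) u1, range (triple u1 u2 u3) u2
    & range (triple u1 u2 u3) u3].
Proof.
by split; [exists (@Ordinal 3 0 isT) | exists (@Ordinal 3 1 isT) | exists (@Ordinal 3 2 isT)].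
Qed.

Lemma range_tripleP (T : Type) (P : T -> Prop) (u1 u2 u3 : T) :
  P u1 -> P u2 -> P u3 -> forall x, range (triple u1 u2 u3) x -> P x.
Proof. by move=> P1 P2 P3 x [[[|[|[|//]]] hi] ->]. Qed.

Lemma range_quadruple (T : Type) (u1 u2 u3 u4 : T) :
  [/\ range (quadruple u1 u2 u3 u4) u1, range (quadruple u1 u2 u3 u4) u2,
      range (quadruple u1 u2 u3 u4) u3 & range (quadruple u1 u2 u3 u4) u4].
Proof.
by split; [exists (@Ordinal 4 0 isT) | exists (@Ordinal 4 1 isT)
  | exists (@Ordinal 4 2 isT) | exists (@Ordinal 4 3 isT)].
Qed.

Lemma range_quadrupleP (T : Type) (P : T -> Prop) (u1 u2 u3 u4 : T) :
  P u1 -> P u2 -> P u3 -> P u4 -> forall x, range (quadruple u1 u2 u3 u4) x -> P x.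
Proof. by move=> P1 P2 P3 P4 x [[[|[|[|[|//]]]] hi] ->]. Qed.

Section Generation.
Variable K : fieldType.
Notation L := (ratfun K 3).
Notation j := (ratC K 3).
Hypothesis two0 : 2%:R != 0 :> L.

Lemma adjoin_ratfun (B : L -> Prop) (f : L) :
  adjoin j B x1 -> adjoin j B x2 -> adjoin j B x3 -> adjoin j B f.
Proof.
move=> B1 B2 B3.
have Bp (p : {mpoly K[3]}) : adjoin j B (FracField.tofrac p).
  rewrite -[p]mmap_id (rmorph_mmap (@FracField.tofrac {mpoly K[3]})).
  apply: adjoin_mmap => i /=.
  by case: i => [[|[|[|//]]] hi]; rewrite (bool_irrelevance hi isT).
have [[p q] /= /andP[_ /eqP ->]] := ratfun_frac f.
by apply: adjoin_mul; [|apply: adjoin_inv].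
Qed.

Lemma fixed_one_step (n : nat) (t : 'I_n -> L) (s : {rmorphism L -> L}) (z : L) :
    (forall k, s k%:K = k%:K) -> (forall y, range t y -> s y = y) ->
    adjoin j (range t) (z ^+ 2) -> s z = - z ->
    (forall f, adjoin j (fun y => range t y \/ y = z) f) ->
  forall f, s f = f <-> adjoin j (range t) f.
Proof.
move=> sj st tz sz gen f; split; last exact: adjoin_fixed.
exact: fixed_adjoin_sqrt sz (gen f).
Qed.

Lemma fixed_two_steps (n : nat) (t : 'I_n -> L) (s s' : {rmorphism L -> L}) (z z' : L) :
    (forall k, s k%:K = k%:K) -> (forall k, s' k%:K = k%:K) ->
    (forall y, range t y -> s y = y) -> (forall y, range t y -> s' y = y) ->
    adjoin j (range t) (z ^+ 2) ->
    adjoin j (fun y => range t y \/ y = z) (z' ^+ 2) ->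
    s z = - z -> s' z = z -> s' z' = - z' ->
    (forall f, adjoin j (fun y => (range t y \/ y = z) \/ y = z') f) ->
  forall f, (s f = f /\ s' f = f) <-> adjoin j (range t) f.
Proof.
move=> sj sj' st st' tz tz' sz s'z s'z' gen f; split; last first.
  by move=> tf; split; apply: adjoin_fixed tf.
move=> [sf s'f]; apply: (fixed_adjoin_sqrt two0 tz sj st sz) sf.
apply: (fixed_adjoin_sqrt two0 tz' sj' _ s'z' (gen f) s'f).
by move=> y [/st'|->].
Qed.

Section Cases.
Variables (a b c : K).
Hypotheses (a0 : a != 0) (b0 : b != 0) (c0 : c != 0).

Let aL0 : a%:K != 0. Proof. by rewrite fmorph_eq0. Qed.
Let bL0 : b%:K != 0. Proof. by rewrite fmorph_eq0. Qed.
Let cL0 : c%:K != 0. Proof. by rewrite fmorph_eq0. Qed.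

Let M1 : L := df a%:K x1.
Let M2 : L := df b%:K x2.
Let M3 : L := df c%:K x3.
Let P3 : L := tr c%:K x3.
Let M12 : L := df (a%:K * b%:K) (x1 * x2).
Let u := M1 / M12.
Let v := M2 / M12.

Let lM1 : has_lead M1 2 0 0 1 0 0.
Proof. exact: (has_lead_df a0 _ (has_lead_x1 K)). Qed.
Let lM2 : has_lead M2 0 2 0 0 1 0.
Proof. exact: (has_lead_df b0 _ (has_lead_x2 K)). Qed.
Let lM3 : has_lead M3 0 0 2 0 0 1.
Proof. exact: (has_lead_df c0 _ (has_lead_x3 K)). Qed.
Let lP3 : has_lead P3 0 0 2 0 0 1.
Proof. exact: (has_lead_tr c0 _ (has_lead_x3 K)). Qed.
Let lM12 : has_lead M12 2 2 0 1 1 0.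
Proof.
rewrite /M12 -(rmorphM j).
exact: (has_lead_df (mulf_neq0 a0 b0) _ (has_lead_mul (has_lead_x1 K) (has_lead_x2 K))).
Qed.
Let lu : has_lead u 3 1 0 3 2 0.
Proof. exact: (has_lead_mul lM1 (has_lead_inv lM12)). Qed.
Let lv : has_lead v 1 3 0 2 3 0.
Proof. exact: (has_lead_mul lM2 (has_lead_inv lM12)). Qed.

Let P1E : tr a%:K x1 = (1 - b%:K * u ^+ 2 + a%:K * v ^+ 2) / v.
Proof.
exact: (inversion_tr1 (x1_neq0 K) (x2_neq0 K) (has_lead_neq0 lM2) (has_lead_neq0 lM12)).
Qed.
Let P2E : tr b%:K x2 = (1 + b%:K * u ^+ 2 - a%:K * v ^+ 2) / u.
Proof.
exact: (inversion_tr2 (x1_neq0 K) (x2_neq0 K) (has_lead_neq0 lM1) (has_lead_neq0 lM12)).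
Qed.
Let M2E : M2 = M1 * v / u.
Proof.
exact: (inversion_df2 (x1_neq0 K) (x2_neq0 K) (has_lead_neq0 lM1) (has_lead_neq0 lM12)).
Qed.

Lemma adjoin_x1_x2 (B : L -> Prop) :
    adjoin j B u -> adjoin j B v -> adjoin j B M1 ->
  adjoin j B x1 /\ adjoin j B x2.
Proof.
move=> Bu Bv BM1; rewrite (tr_df_half a%:K x1 two0) (tr_df_half b%:K x2 two0).
by rewrite -/M1 -/M2 P1E P2E M2E; split; adjoin_closure.
Qed.

Lemma adjoin_sqr_M1 (B : L -> Prop) :
  adjoin j B u -> adjoin j B v -> adjoin j B (M1 ^+ 2).
Proof.
by move=> Bu Bv; rewrite /M1 (df_sqr _ (x1_neq0 K)) P1E; adjoin_closure.
Qed.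

Lemma adjoin_x3 (B : L -> Prop) :
  adjoin j B P3 -> adjoin j B M3 -> adjoin j B x3.
Proof.
by move=> BP BM; rewrite (tr_df_half c%:K x3 two0) -/M3 -/P3; adjoin_closure.
Qed.

Lemma adjoin_sqr_M3 (B : L -> Prop) : adjoin j B P3 -> adjoin j B (M3 ^+ 2).
Proof. by move=> BP; rewrite /M3 (df_sqr _ (x3_neq0 K)) -/P3; adjoin_closure. Qed.

Variables (e1 e2 e3 : K).
Hypotheses (he1 : e1 = 1 \/ e1 = -1) (he2 : e2 = 1 \/ e2 = -1)
  (he3 : e3 = 1 \/ e3 = -1).
Variables (s1 s2 : {rmorphism L -> L}).
Hypotheses (s1C : forall k, s1 k%:K = k%:K) (s2C : forall k, s2 k%:K = k%:K).
Hypothesis (s1E : [/\ s1 x1 = e1%:K * x1, s1 x2 = e2%:K * x2 & s1 x3 = c%:K / x3]).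
Hypothesis (s2E : [/\ s2 x1 = a%:K / x1, s2 x2 = b%:K / x2 & s2 x3 = e3%:K * x3]).

Let signL (e : K) : e = 1 \/ e = -1 -> e%:K = 1 \/ e%:K = -1.
Proof. by case=> ->; [left; rewrite rmorph1 | right; rewrite rmorphN1]. Qed.

Let s1M1 : s1 M1 = e1%:K * M1.
Proof. by case: s1E => E _ _; rewrite /M1 rmorph_df // E (df_sign _ _ (signL he1)). Qed.
Let s1M2 : s1 M2 = e2%:K * M2.
Proof. by case: s1E => _ E _; rewrite /M2 rmorph_df // E (df_sign _ _ (signL he2)). Qed.
Let s1M12 : s1 M12 = e1%:K * e2%:K * M12.
Proof.
have sab : s1 (a%:K * b%:K) = a%:K * b%:K by rewrite rmorphM /= !s1C.
case: s1E => E1 E2 _; rewrite /M12 rmorph_df //.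
rewrite rmorphM /= E1 E2 mulrACA; apply: df_sign; rewrite -(rmorphM j); apply: signL.
by case: he1 => ->; case: he2 => ->; rewrite ?mulrNN ?mulr1 ?mul1r; auto.
Qed.
Let s1M3 : s1 M3 = - M3.
Proof. by case: s1E => _ _ E; rewrite /M3 rmorph_df // E (df_inversion cL0 (x3_neq0 K)). Qed.
Let s1P3 : s1 P3 = P3.
Proof. by case: s1E => _ _ E; rewrite /P3 rmorph_tr // E (tr_inversion cL0 (x3_neq0 K)). Qed.
Let s1u : s1 u = e2%:K * u.
Proof.
rewrite /u fmorph_div s1M1 s1M12.
by case: (signL he1) => ->; case: (signL he2) => ->;
  rewrite ?(mul1r, mulr1, mulNr, invrN, mulrN, opprK).
Qed.
Let s1v : s1 v = e1%:K * v.
Proof.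
rewrite /v fmorph_div s1M2 s1M12.
by case: (signL he1) => ->; case: (signL he2) => ->;
  rewrite ?(mul1r, mulr1, mulNr, invrN, mulrN, opprK).
Qed.
Let s2M1 : s2 M1 = - M1.
Proof. by case: s2E => E _ _; rewrite /M1 rmorph_df // E (df_inversion aL0 (x1_neq0 K)). Qed.
Let s2M2 : s2 M2 = - M2.
Proof. by case: s2E => _ E _; rewrite /M2 rmorph_df // E (df_inversion bL0 (x2_neq0 K)). Qed.
Let s2M12 : s2 M12 = - M12.
Proof.
have sab : s2 (a%:K * b%:K) = a%:K * b%:K by rewrite rmorphM /= !s2C.
case: s2E => E1 E2 _; rewrite /M12 rmorph_df //.
rewrite rmorphM /= E1 E2 mulf_div.
by rewrite (df_inversion (mulf_neq0 aL0 bL0) (mulf_neq0 (x1_neq0 K) (x2_neq0 K))).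
Qed.
Let s2M3 : s2 M3 = e3%:K * M3.
Proof. by case: s2E => _ _ E; rewrite /M3 rmorph_df // E (df_sign _ _ (signL he3)). Qed.
Let s2P3 : s2 P3 = e3%:K * P3.
Proof. by case: s2E => _ _ E; rewrite /P3 rmorph_tr // E (tr_sign _ _ (signL he3)). Qed.
Let s2u : s2 u = u.
Proof. by rewrite /u fmorph_div s2M1 s2M12 invrN mulrNN. Qed.
Let s2v : s2 v = v.
Proof. by rewrite /v fmorph_div s2M2 s2M12 invrN mulrNN. Qed.

Lemma rational_trivial_e3 : e3 = 1 ->
  purely_transcendental j (fixed_field (generated_group (fun s => s = s1 \/ s = s2))).
Proof.
move=> e31.
pose u' := if e2 == 1 then u else u * M3.
pose v' := if e1 == 1 then v else v * M3.
have M30 := has_lead_neq0 lM3.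
have N11 : (-1 == 1 :> K) = false.
  apply/negP => /eqP m11; move/negP: two0; apply.
  by rewrite -(rmorph_nat j) fmorph_eq0 mulr2n -{1}m11 addNr.
apply: (@purely_transcendental_range _ _ _ _ (triple u' v' P3)).
  rewrite /u' /v'; case: he1 => ->; case: he2 => ->; rewrite ?eqxx ?N11.
  - by apply: (has_lead_independent lu lv lP3) => ? ? ? ? ? ? [E1 E2 E3];
      clear -E1 E2 E3; split; lia.
  - by apply: (has_lead_independent (has_lead_mul lu lM3) lv lP3) => ? ? ? ? ? ? [E1 E2 E3];
      clear -E1 E2 E3; split; lia.
  - apply: (has_lead_independent lu (has_lead_mul lv lM3) lP3).
    move=> ? ? ? ? ? ? [E1 E2 E3]; clear -E1 E2 E3; split; lia.
  - apply: (has_lead_independent (has_lead_mul lu lM3) (has_lead_mul lv lM3) lP3).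
    move=> ? ? ? ? ? ? [E1 E2 E3]; clear -E1 E2 E3; split; lia.
move=> f; rewrite fixed_field_gen2.
have s2M3' : s2 M3 = M3 by rewrite s2M3 e31 rmorph1 mul1r.
have s2P3' : s2 P3 = P3 by rewrite s2P3 e31 rmorph1 mul1r.
have [t1 t2 t3] := range_triple u' v' P3.
have uv (B : L -> Prop) : adjoin j B u' -> adjoin j B v' -> adjoin j B M3 ->
    adjoin j B u /\ adjoin j B v.
  rewrite /u' /v' => Bu Bv BM; split; [move: Bu | move: Bv].
    case: ifP => _ // Bu; rewrite -(mulfK M30 u); adjoin_closure.
  case: ifP => _ // Bv; rewrite -(mulfK M30 v); adjoin_closure.
apply: (@fixed_two_steps _ _ s1 s2 M3 M1) => //.
- apply: range_tripleP => //.
    rewrite /u'; case: he2 => E; rewrite E ?eqxx ?N11.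
      by rewrite s1u E rmorph1 mul1r.
    by rewrite (rmorphM s1) /= s1u s1M3 E rmorphN1 mulN1r mulrNN.
  rewrite /v'; case: he1 => E; rewrite E ?eqxx ?N11.
    by rewrite s1v E rmorph1 mul1r.
  by rewrite (rmorphM s1) /= s1v s1M3 E rmorphN1 mulN1r mulrNN.
- apply: range_tripleP => //.
    by rewrite /u'; case: ifP => _; [|rewrite (rmorphM s2) /= s2M3']; rewrite s2u.
  by rewrite /v'; case: ifP => _; [|rewrite (rmorphM s2) /= s2M3']; rewrite s2v.
- by apply: adjoin_sqr_M3; apply: adjoin_mem.
- set B := fun _ => _.
  have BM : adjoin j B M3 by apply: adjoin_mem; right.
  have Bu : adjoin j B u' by apply: adjoin_mem; left.
  have Bv : adjoin j B v' by apply: adjoin_mem; left.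
  by have [? ?] := uv B Bu Bv BM; apply: adjoin_sqr_M1.
move=> g; set B := fun _ => _.
have BM : adjoin j B M3 by apply: adjoin_mem; left; right.
have Bu : adjoin j B u' by apply: adjoin_mem; left; left.
have Bv : adjoin j B v' by apply: adjoin_mem; left; left.
have BP : adjoin j B P3 by apply: adjoin_mem; left; left.
have BM1 : adjoin j B M1 by apply: adjoin_mem; right.
have [? ?] := uv B Bu Bv BM; have [? ?] : adjoin j B x1 /\ adjoin j B x2.
  exact: adjoin_x1_x2.
by apply: adjoin_ratfun => //; apply: adjoin_x3.
Qed.

Lemma rational_trivial_e1_e2 : e1 = 1 -> e2 = 1 -> e3 = -1 ->
  purely_transcendental j (fixed_field (generated_group (fun s => s = s1 \/ s = s2))).
Proof.
move=> e11 e21 e31; have M10 := has_lead_neq0 lM1.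
apply: (@purely_transcendental_range _ _ _ _ (triple u v (P3 * M1))).
  by apply: (has_lead_independent lu lv (has_lead_mul lP3 lM1)) => ? ? ? ? ? ? [E1 E2 E3];
      clear -E1 E2 E3; split; lia.
move=> f; rewrite fixed_field_gen2.
have s1M1' : s1 M1 = M1 by rewrite s1M1 e11 rmorph1 mul1r.
have [t1 t2 t3] := range_triple u v (P3 * M1).
have BP3 (B : L -> Prop) : adjoin j B (P3 * M1) -> adjoin j B M1 -> adjoin j B P3.
  by move=> BPM BM; rewrite -(mulfK M10 P3); adjoin_closure.
rewrite and_comm; apply: (@fixed_two_steps _ _ s2 s1 M1 M3) => //.
- by apply: range_tripleP => //; rewrite (rmorphM s2) /= s2P3 s2M1 e31 rmorphN1 mulN1r mulrNN.
- apply: range_tripleP; last by rewrite (rmorphM s1) /= s1P3 s1M1'.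
    by rewrite s1u e21 rmorph1 mul1r.
  by rewrite s1v e11 rmorph1 mul1r.
- by apply: adjoin_sqr_M1; apply: adjoin_mem.
- by apply/adjoin_sqr_M3/BP3; apply: adjoin_mem; [left | right].
move=> g; set B := fun _ => _.
have BM : adjoin j B M3 by apply: adjoin_mem; right.
have Bu : adjoin j B u by apply: adjoin_mem; left; left.
have Bv : adjoin j B v by apply: adjoin_mem; left; left.
have BM1 : adjoin j B M1 by apply: adjoin_mem; left; right.
have BP : adjoin j B P3 by apply: BP3 => //; apply: adjoin_mem; left; left.
have [? ?] : adjoin j B x1 /\ adjoin j B x2 by exact: adjoin_x1_x2.
by apply: adjoin_ratfun => //; apply: adjoin_x3.
Qed.

End Cases.
End Generation.

Section Covers.
Variable K : fieldType.
Notation L := (ratfun K 3).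
Notation j := (ratC K 3).
Variables (a b c : K).
Hypotheses (two0 : 2%:R != 0 :> L) (a0 : a != 0) (b0 : b != 0) (c0 : c != 0).

Let aL0 : a%:K != 0. Proof. by rewrite fmorph_eq0. Qed.
Let bL0 : b%:K != 0. Proof. by rewrite fmorph_eq0. Qed.
Let cL0 : c%:K != 0. Proof. by rewrite fmorph_eq0. Qed.
Let l2 : has_lead (2%:R : L) 0 0 0 0 0 0.
Proof.
have two_j : j 2%:R = 2%:R :> L := rmorph_nat j 2.
by rewrite -two_j; apply: has_lead_C; move: two0; rewrite -two_j fmorph_eq0.
Qed.
Let l4 : has_lead (4%:R : L) 0 0 0 0 0 0.
Proof. by rewrite (natrM _ 2 2); apply: (has_lead_mul l2 l2). Qed.

Section Source.
Let P1 : L := tr a%:K x1.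
Let M1 : L := df a%:K x1.
Let P2 : L := tr b%:K x2.
Let M2 : L := df b%:K x2.
Let P3 : L := tr c%:K x3.
Let M3 : L := df c%:K x3.
Let d : L := M1 * P2 - P1 * M2.
Let p : L := M3 * P1 / (2%:R * P3).
Let w : L := M3 * P2 / (2%:R * P3).
Let r : L := (P3 ^+ 2 * (M1 * M2) - 4%:R * c%:K * (P1 * P2)) / (2%:R * (P3 * d)).
Let q : L := d / (2%:R * P3).

Let lP1 : has_lead P1 2 0 0 1 0 0.
Proof. exact: (has_lead_tr a0 _ (has_lead_x1 K)). Qed.
Let lM1 : has_lead M1 2 0 0 1 0 0.
Proof. exact: (has_lead_df a0 _ (has_lead_x1 K)). Qed.
Let lP2 : has_lead P2 0 2 0 0 1 0.
Proof. exact: (has_lead_tr b0 _ (has_lead_x2 K)). Qed.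
Let lM2 : has_lead M2 0 2 0 0 1 0.
Proof. exact: (has_lead_df b0 _ (has_lead_x2 K)). Qed.
Let lP3 : has_lead P3 0 0 2 0 0 1.
Proof. exact: (has_lead_tr c0 _ (has_lead_x3 K)). Qed.
Let lM3 : has_lead M3 0 0 2 0 0 1.
Proof. exact: (has_lead_df c0 _ (has_lead_x3 K)). Qed.

Let ld : has_lead d 2 0 0 1 1 0 \/ has_lead d 0 2 0 1 1 0.
Proof.
rewrite /d /M1 /P1 /M2 /P2 (source_den _ _ (x1_neq0 K) (x2_neq0 K)).
have l12 := has_lead_mul (has_lead_x1 K) (has_lead_inv (has_lead_x2 K)).
have l21 := has_lead_mul (has_lead_x2 K) (has_lead_inv (has_lead_x1 K)).
exact: (has_lead_add_neq (has_lead_mul l2 (has_lead_mul (has_lead_C b0) l12))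
  (has_lead_opp (has_lead_mul l2 (has_lead_mul (has_lead_C a0) l21)))).
Qed.

Let d0 : d != 0. Proof. by case: ld => /has_lead_neq0. Qed.
Let P30 : P3 != 0. Proof. exact: has_lead_neq0 lP3. Qed.
Let M30 : M3 != 0. Proof. exact: has_lead_neq0 lM3. Qed.

Lemma source_on_cover : on_cover j a b c p w r q.
Proof. exact: (source_cover two0 (x1_neq0 K) (x2_neq0 K) (x3_neq0 K) P30 d0). Qed.

Lemma source_independent : independent3 j p w r.
Proof.
have lden := has_lead_inv (has_lead_mul l2 lP3).
have lp := has_lead_mul (has_lead_mul lM3 lP1) lden.
have lw := has_lead_mul (has_lead_mul lM3 lP2) lden.
have lnum := has_lead_add
  (has_lead_mul (has_lead_mul lP3 lP3) (has_lead_mul lM1 lM2))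
  (has_lead_opp (has_lead_mul (has_lead_mul l4 (has_lead_C c0)) (has_lead_mul lP1 lP2)))
  isT.
case: ld => ld'; have lr := has_lead_mul lnum
    (has_lead_inv (has_lead_mul l2 (has_lead_mul lP3 ld')));
  by apply: (has_lead_independent lp lw lr) => ? ? ? ? ? ? [E1 E2 E3];
      clear -E1 E2 E3; split; lia.
Qed.

Variables (s1 s2 : {rmorphism L -> L}).
Hypotheses (s1C : forall k, s1 k%:K = k%:K) (s2C : forall k, s2 k%:K = k%:K).
Hypothesis (s1E : [/\ s1 x1 = - x1, s1 x2 = - x2 & s1 x3 = c%:K / x3]).
Hypothesis (s2E : [/\ s2 x1 = a%:K / x1, s2 x2 = b%:K / x2 & s2 x3 = - x3]).

Let s1P1 : s1 P1 = - P1.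
Proof. by case: s1E => E _ _; rewrite /P1 rmorph_tr // E tr_opp. Qed.
Let s1M1 : s1 M1 = - M1.
Proof. by case: s1E => E _ _; rewrite /M1 rmorph_df // E df_opp. Qed.
Let s1P2 : s1 P2 = - P2.
Proof. by case: s1E => _ E _; rewrite /P2 rmorph_tr // E tr_opp. Qed.
Let s1M2 : s1 M2 = - M2.
Proof. by case: s1E => _ E _; rewrite /M2 rmorph_df // E df_opp. Qed.
Let s1P3 : s1 P3 = P3.
Proof. by case: s1E => _ _ E; rewrite /P3 rmorph_tr // E (tr_inversion cL0 (x3_neq0 K)). Qed.
Let s1M3 : s1 M3 = - M3.
Proof. by case: s1E => _ _ E; rewrite /M3 rmorph_df // E (df_inversion cL0 (x3_neq0 K)). Qed.
Let s2P1 : s2 P1 = P1.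
Proof. by case: s2E => E _ _; rewrite /P1 rmorph_tr // E (tr_inversion aL0 (x1_neq0 K)). Qed.
Let s2M1 : s2 M1 = - M1.
Proof. by case: s2E => E _ _; rewrite /M1 rmorph_df // E (df_inversion aL0 (x1_neq0 K)). Qed.
Let s2P2 : s2 P2 = P2.
Proof. by case: s2E => _ E _; rewrite /P2 rmorph_tr // E (tr_inversion bL0 (x2_neq0 K)). Qed.
Let s2M2 : s2 M2 = - M2.
Proof. by case: s2E => _ E _; rewrite /M2 rmorph_df // E (df_inversion bL0 (x2_neq0 K)). Qed.
Let s2P3 : s2 P3 = - P3.
Proof. by case: s2E => _ _ E; rewrite /P3 rmorph_tr // E tr_opp. Qed.
Let s2M3 : s2 M3 = - M3.
Proof. by case: s2E => _ _ E; rewrite /M3 rmorph_df // E df_opp. Qed.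

Let frac_fixed (s : {rmorphism L -> L}) (f g : L) :
  (s f = f /\ s g = g) \/ (s f = - f /\ s g = - g) -> s (f / g) = f / g.
Proof. by rewrite fmorph_div => -[[-> ->]|[-> ->]]; rewrite ?invrN ?mulrNN. Qed.

Let mul_nat (s : {rmorphism L -> L}) (m : nat) (f : L) : s (m%:R * f) = m%:R * s f.
Proof. by rewrite rmorphM rmorph_nat. Qed.

Let s1d : s1 d = d.
Proof.
by rewrite /d (rmorphB s1) !(rmorphM s1) /= s1M1 s1P2 s1P1 s1M2 !mulrNN.
Qed.
Let s2d : s2 d = - d.
Proof.
by rewrite /d (rmorphB s2) !(rmorphM s2) /= s2M1 s2P2 s2P1 s2M2 mulNr mulrN opprD.
Qed.

Let num : L := P3 ^+ 2 * (M1 * M2) - 4%:R * c%:K * (P1 * P2).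
Let num_fixed (s : {rmorphism L -> L}) :
    s c%:K = c%:K -> s P3 = P3 \/ s P3 = - P3 -> s M1 = - M1 -> s M2 = - M2 ->
    (s P1 = P1 /\ s P2 = P2) \/ (s P1 = - P1 /\ s P2 = - P2) ->
  s num = num.
Proof.
move=> sc sP3 sM1 sM2 sP; rewrite /num (rmorphB s) (rmorphM s) (rmorphM s (_ * _)).
rewrite (rmorphXn s) (rmorphM s M1) (rmorphM s P1) mul_nat /= sc sM1 sM2.
by case: sP3 => ->; case: sP => -[-> ->]; rewrite ?sqrrN ?mulrNN.
Qed.

Lemma source_fixed (f : L) :
  fixed_field (generated_group (fun s => s = s1 \/ s = s2)) f <->
  adjoin j (range (quadruple p w r q)) f.
Proof.
rewrite fixed_field_gen2 and_comm.
have [tp tw tr' tq] := range_quadruple p w r q.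
pose B0 := range (quadruple p w r q).
have Bp : adjoin j B0 p by apply: adjoin_mem.
have Bw : adjoin j B0 w by apply: adjoin_mem.
have Br : adjoin j B0 r by apply: adjoin_mem.
have Bq : adjoin j B0 q by apply: adjoin_mem.
pose B1 y := B0 y \/ y = P3.
have B01 y : adjoin j B0 y -> adjoin j B1 y.
  by apply: adjoin_sub => z Bz; apply: adjoin_mem; left.
have BP3 : adjoin j B1 P3 by apply: adjoin_mem; right.
have W1 : adjoin j B1 (x2 * M3).
  rewrite -(divfK two0 (x2 * M3)).
  have -> : x2 * M3 / 2%:R = r * w - p * (w ^+ 2 - b%:K) / q + w * (P3 / 2%:R).
    exact: (source_product two0 (x2_neq0 K) (x3_neq0 K) P30 d0).
  have := B01 p Bp; have := B01 w Bw; have := B01 r Br; have := B01 q Bq.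
  by move=> *; adjoin_closure.
have R1 : adjoin j B1 (b%:K * x1 / x2).
  have -> : b%:K * x1 / x2 = p * w - r * q + q * (P3 / 2%:R).
    exact: (source_ratio two0 (x1_neq0 K) (x2_neq0 K) (x3_neq0 K) P30 d0).
  have := B01 p Bp; have := B01 w Bw; have := B01 r Br; have := B01 q Bq.
  by move=> *; adjoin_closure.
apply: (@fixed_two_steps _ two0 _ _ s2 s1 P3 x2) => //.
- apply: range_quadrupleP.
  + apply: frac_fixed; right.
    by rewrite mul_nat (rmorphM s2) /= s2M3 s2P1 s2P3 mulNr mulrN.
  + apply: frac_fixed; right.
    by rewrite mul_nat (rmorphM s2) /= s2M3 s2P2 s2P3 mulNr mulrN.
  + apply: frac_fixed; left; split; first by apply: num_fixed; auto.
    by rewrite mul_nat (rmorphM s2) /= s2P3 s2d mulrNN.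
  + by apply: frac_fixed; right; rewrite mul_nat s2d s2P3 mulrN.
- apply: range_quadrupleP.
  + apply: frac_fixed; left.
    by rewrite mul_nat (rmorphM s1) /= s1M3 s1P1 s1P3 mulrNN.
  + apply: frac_fixed; left.
    by rewrite mul_nat (rmorphM s1) /= s1M3 s1P2 s1P3 mulrNN.
  + apply: frac_fixed; left; split; first by apply: num_fixed; auto.
    by rewrite mul_nat (rmorphM s1) /= s1P3 s1d.
  + by apply: frac_fixed; left; rewrite mul_nat s1d s1P3.
- have -> : P3 ^+ 2 = 4%:R * ((p * w - r * q) ^+ 2 - a%:K * b%:K) / q ^+ 2.
    exact: (source_sqr two0 (x1_neq0 K) (x2_neq0 K) (x3_neq0 K) P30 d0).
  by adjoin_closure.
- have -> : x2 ^+ 2 = (x2 * M3) ^+ 2 / (P3 ^+ 2 - 4%:R * c%:K) :> L.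
    have <- : M3 ^+ 2 = P3 ^+ 2 - 4%:R * c%:K by exact: (df_sqr c%:K (x3_neq0 K)).
    by rewrite exprMn (mulfK (expf_neq0 2 M30)).
  by adjoin_closure.
- by case: s1E.
move=> g; set B := fun _ => _.
have B1B y : adjoin j B1 y -> adjoin j B y.
  by apply: adjoin_sub => z Bz; apply: adjoin_mem; left.
have Bx2 : adjoin j B x2 by apply: adjoin_mem; right.
have BP := B1B _ BP3; have BW := B1B _ W1; have BR := B1B _ R1.
apply: adjoin_ratfun => //.
  have -> : x1 = b%:K * x1 / x2 * x2 / b%:K :> L.
    by rewrite (divfK (x2_neq0 K)) [b%:K * _]mulrC (mulfK bL0).
  by adjoin_closure.
apply: (adjoin_x3 two0 BP).
have -> : df c%:K x3 = x2 * M3 / x2 by rewrite [x2 * _]mulrC (mulfK (x2_neq0 K)).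
by adjoin_closure.
Qed.

End Source.

Section Target.
Let N : L := - b%:K * x1 ^+ 2 + c%:K.
Let p : L := tr a%:K x2 / 2%:R.
Let q : L := df a%:K x2 / (2%:R * x1).
Let r : L := tr N x3 / 2%:R.
Let w : L := df N x3 / (2%:R * x1).

Let lM : has_lead (df a%:K x2 : L) 0 2 0 0 1 0.
Proof. exact: (has_lead_df a0 _ (has_lead_x2 K)). Qed.
Let M0 : df a%:K x2 != 0 :> L. Proof. exact: has_lead_neq0 lM. Qed.

Let lN : has_lead N 2 0 0 0 0 0.
Proof.
exact: (has_lead_add (has_lead_mul (has_lead_opp (has_lead_C b0))
  (has_lead_mul (has_lead_x1 K) (has_lead_x1 K))) (has_lead_C c0)).
Qed.
Let N0 : N != 0. Proof. exact: has_lead_neq0 lN. Qed.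

Lemma target_on_cover : on_cover j a b c p w r q.
Proof. exact: (target_cover _ _ _ two0 (x1_neq0 K) (x2_neq0 K) (x3_neq0 K)). Qed.

Lemma target_independent : independent3 j p w r.
Proof.
have ltr : has_lead (tr a%:K x2 : L) 0 2 0 0 1 0.
  exact: (has_lead_tr a0 _ (has_lead_x2 K)).
have lp := has_lead_mul ltr (has_lead_inv l2).
have lN3 := has_lead_mul lN (has_lead_inv (has_lead_x3 K)).
have [lt|lt] := has_lead_add_neq (has_lead_x3 K) lN3 isT;
have [ld|ld] := has_lead_add_neq (has_lead_x3 K) (has_lead_opp lN3) isT;
have lr := has_lead_mul lt (has_lead_inv l2);
have lw := has_lead_mul ld (has_lead_inv (has_lead_mul l2 (has_lead_x1 K)));
by apply: (has_lead_independent lp lw lr) => ? ? ? ? ? ? [E1 E2 E3];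
      clear -E1 E2 E3; split; lia.
Qed.

(* The substitution x2 := a / x2 fixes p, w, r and negates q. *)
Lemma target_irrational : irrational j p w r q.
Proof.
have [|s [[_ sC] sX]] := @Kautomorphism_exists K 3 (triple x1 (a%:K / x2) x3).
  have scale1 (t : 'I_3 -> L) i : t i = ratX K i -> t i = ratC K 3 1 * ratX K i.
    by rewrite rmorph1 mul1r.
  case=> [[|[|[|//]]] hi].
  - by apply: (scale_cond (mulr1 1)); apply: scale1; rewrite (bool_irrelevance hi isT).
  - apply: (inverse_cond (mpolyC_neq0 3 a0) (ratfunC_cond _ _)).
    by rewrite /triple /= (bool_irrelevance hi isT).
  - by apply: (scale_cond (mulr1 1)); apply: scale1; rewrite (bool_irrelevance hi isT).
have s_x1 : s x1 = x1 by rewrite [LHS]sX.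
have s_x2 : s x2 = a%:K / x2 by rewrite [LHS]sX.
have s_x3 : s x3 = x3 by rewrite [LHS]sX.
have sN : s N = N.
  by rewrite /N (rmorphD s) (rmorphM s) (rmorphN s) (rmorphXn s) /= s_x1 !sC.
have sp : s p = p.
  rewrite /p fmorph_div rmorph_nat rmorph_tr //.
  by rewrite s_x2 (tr_inversion aL0 (x2_neq0 K)).
have sr : s r = r by rewrite /r fmorph_div rmorph_nat rmorph_tr // s_x3.
have sw : s w = w.
  by rewrite /w fmorph_div rmorph_df // (rmorphM s) rmorph_nat /= s_x3 s_x1.
have sq : s q = - q.
  rewrite /q fmorph_div rmorph_df // (rmorphM s) rmorph_nat /= s_x1.
  by rewrite s_x2 (df_inversion aL0 (x2_neq0 K)) mulNr.
have q0 : q != 0 by exact: (mulf_neq0 M0 (invr_neq0 (mulf_neq0 two0 (x1_neq0 K)))).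
have s_fix (f : {mpoly K[3]}) : s (mmap j (triple p w r) f) = mmap j (triple p w r) f.
  rewrite rmorph_mmap; apply: eq_mmap => [k|i] /=; first exact: sC.
  by case: i => [[|[|[|//]]] hi].
move=> f g fg0; apply: target_independent.
have := congr1 s fg0; rewrite rmorph0 (rmorphD s) (rmorphM s) /= !s_fix sq.
move/eqP: fg0; rewrite addr_eq0 => /eqP ->.
rewrite mulrN -opprD => /eqP; rewrite oppr_eq0 -mulr2n -mulr_natl.
by rewrite mulf_eq0 (negPf two0) /= mulf_eq0 (negPf q0) orbF => /eqP.
Qed.

Lemma target_fixed (s : {rmorphism L -> L}) :
    (forall k, s k%:K = k%:K) ->
    [/\ s x1 = - x1, s x2 = a%:K / x2 & s x3 = (- b%:K * x1 ^+ 2 + c%:K) / x3] ->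
  forall f, fixed_field (generated_group (fun t => t = s)) f <->
            adjoin j (range (quadruple p w r q)) f.
Proof.
move=> sC [s_x1 s_x2 s_x3] f; rewrite fixed_field_gen1.
have [tp tw tr' tq] := range_quadruple p w r q.
have sN : s N = N.
  by rewrite /N (rmorphD s) (rmorphM s) (rmorphN s) (rmorphXn s) /= s_x1 !sC sqrrN.
have sp : s p = p.
  rewrite /p fmorph_div rmorph_nat rmorph_tr //.
  by rewrite s_x2 (tr_inversion aL0 (x2_neq0 K)).
have sr : s r = r.
  rewrite /r fmorph_div rmorph_nat rmorph_tr //.
  by rewrite s_x3 (tr_inversion N0 (x3_neq0 K)).
have sw : s w = w.
  rewrite /w fmorph_div rmorph_df // (rmorphM s) rmorph_nat /= s_x3 s_x1.
  by rewrite (df_inversion N0 (x3_neq0 K)) mulrN invrN mulrNN.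
have sq : s q = q.
  rewrite /q fmorph_div rmorph_df // (rmorphM s) rmorph_nat /= s_x1.
  by rewrite s_x2 (df_inversion aL0 (x2_neq0 K)) mulrN invrN mulrNN.
apply: (@fixed_one_step _ two0 _ _ s x1) => //.
- exact: range_quadrupleP.
- have Bp := adjoin_mem j tp; have Bq := adjoin_mem j tq.
  rewrite (target_sqr two0 (x1_neq0 K) (x2_neq0 K) M0) -/p -/q.
  by adjoin_closure.
move=> g; set B := fun _ => _.
have Bp : adjoin j B p by apply: adjoin_mem; left.
have Bw : adjoin j B w by apply: adjoin_mem; left.
have Br : adjoin j B r by apply: adjoin_mem; left.
have Bq : adjoin j B q by apply: adjoin_mem; left.
have Bx1 : adjoin j B x1 by apply: adjoin_mem; right.
apply: adjoin_ratfun => //.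
  by rewrite (target_x2 a%:K two0 (x1_neq0 K) (x2_neq0 K)) -/p -/q; adjoin_closure.
rewrite (target_x3 b%:K c%:K two0 (x1_neq0 K) (x3_neq0 K)) -/N -/r -/w.
by adjoin_closure.
Qed.

End Target.
End Covers.

Theorem theorem4 (K : fieldType) (charK : 2%N \notin [pchar K])
  (a b c : K) (a0 : a != 0) (b0 : b != 0) (c0 : c != 0)
  (e1 e2 e3 : K)
  (he1 : e1 = 1 \/ e1 = -1) (he2 : e2 = 1 \/ e2 = -1) (he3 : e3 = 1 \/ e3 = -1)
  (s1 s2 : {rmorphism ratfun K 3 -> ratfun K 3})
  (s1_aut : Kautomorphism (ratC K 3) s1)
  (s1E : [/\ s1 x1 = e1%:K * x1, s1 x2 = e2%:K * x2 & s1 x3 = c%:K / x3])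
  (s2_aut : Kautomorphism (ratC K 3) s2)
  (s2E : [/\ s2 x1 = a%:K / x1, s2 x2 = b%:K / x2 & s2 x3 = e3%:K * x3]) :
  let G := generated_group (fun s => s = s1 \/ s = s2) in
  ((e1 = 1 /\ e2 = 1) \/ e3 = 1 ->
     purely_transcendental (ratC K 3) (fixed_field G)) /\
  (e1 = -1 /\ e2 = -1 /\ e3 = -1 ->
     forall sabc : {rmorphism ratfun K 3 -> ratfun K 3},
       Kautomorphism (ratC K 3) sabc ->
       [/\ sabc x1 = - x1, sabc x2 = a%:K / x2 &
           sabc x3 = (- b%:K * x1 ^+ 2 + c%:K) / x3] ->
       (purely_transcendental (ratC K 3) (fixed_field G) <->
        purely_transcendental (ratC K 3)
          (fixed_field (generated_group (fun s => s = sabc))))).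
Proof.
have two0K : 2%:R != 0 :> K by move: charK; rewrite inE /=.
have two_j : ratC K 3 2%:R = 2%:R := rmorph_nat (ratC K 3) 2.
have two0 : 2%:R != 0 :> ratfun K 3 by rewrite -two_j fmorph_eq0.
case: s1_aut => _ s1C; case: s2_aut => _ s2C G; split.
  move=> signs; have [e31|e3N] := he3.
    exact: (rational_trivial_e3 two0 a0 b0 c0 he1 he2 he3 s1C s2C s1E s2E).
  case: signs => [[e11 e21]|e31].
    exact: (rational_trivial_e1_e2 two0 a0 b0 c0 he1 he2 he3 s1C s2C s1E s2E).
  exact: (rational_trivial_e3 two0 a0 b0 c0 he1 he2 he3 s1C s2C s1E s2E).
move=> [e1N [e2N e3N]] sabc [_ sabcC] sabcE.
have sign_opp (x : ratfun K 3) : (-1)%:K * x = - x by rewrite rmorphN1 mulN1r.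
rewrite e1N e2N !sign_opp in s1E; rewrite e3N sign_opp in s2E.
have src := source_fixed two0 a0 b0 c0 s1C s2C s1E s2E.
have tgt := target_fixed two0 a0 b0 c0 sabcC sabcE.
have s_cov := source_on_cover two0 a0 b0 c0.
have s_ind := source_independent two0 a0 b0 c0.
have t_cov := target_on_cover a b c two0.
have t_ind := target_independent two0 a0 b0 c0.
have t_irr := target_irrational two0 a0 b0 c0.
have s_irr := irrational_transfer t_cov t_ind s_cov s_ind t_irr.
have s_t := cover_same_relations s_cov s_ind s_irr t_cov t_ind.
have t_s := cover_same_relations t_cov t_ind t_irr s_cov s_ind.
split=> pt.
  apply: (purely_transcendental_ext (fun f => iff_sym (tgt f))).
  apply: (purely_transcendental_transfer (fun f => conj (s_t f) (t_s f))).
  exact: (purely_transcendental_ext src).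
apply: (purely_transcendental_ext (fun f => iff_sym (src f))).
apply: (purely_transcendental_transfer (fun f => conj (t_s f) (s_t f))).
exact: (purely_transcendental_ext tgt).
Qed.
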